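(* Let $q\in\mathbb{C}$, $|q|=1$, and let $R_4=\frac{q}{\sqrt2}\begin{pmatrix}1&1&0&0\\-1&1&0&0\\0&0&1&-1\\0&0&1&1\end{pmatrix}\in M_2\otimes M_2\cong\mathcal{F}_2^2$. An element $x\in\mathcal{F}_2^n$, $n\in\mathbb{N}$, $n\ge1$, is a fixed point of $\lambda_{R_4}$ if and only if it is a linear combination of elements of the form $\sigma_{i_1}\varphi(\sigma_{i_2})\cdots\varphi^{n-1}(\sigma_{i_n})$, with $i_1,\dots,i_n\in\{0,1,2,3\}$, where the following three conditions are satisfied: (a) $i_n\in\{0,3\}$; (b) if $i_k\in\{0,2\}$ for some $k\in\{2,\dots,n\}$, then $i_{k-1}\in\{0,3\}$; (c) if $i_k\in\{1,3\}$ for some $k\in\{2,\dots,n\}$, then $i_{k-1}\in\{1,2\}$. Moreover, $\dim(\mathcal{F}_2^n)^{\lambda_{R_4}}=2^n$ and $\mathcal{N}^{\lambda_{R_4}}=\big({}^0\mathcal{F}_2^{\lambda_{R_4}}\big)''$.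
   Context: $\mathcal{O}_2$ is the Cuntz algebra generated by isometries $S_1,S_2$ with $S_i^*S_j=\delta_{ij}1$, $S_1S_1^*+S_2S_2^*=1$. $\mathcal{F}_2^n=\mathrm{span}\{S_\mu S_\nu^*:|\mu|=|\nu|=n\}\cong M_2^{\otimes n}$, and $\mathcal{F}_2$ is the norm closure of ${}^0\mathcal{F}_2:=\bigcup_n\mathcal{F}_2^n$. A matrix $R\in M_2\otimes M_2$, written with respect to the ordered basis $e_1\otimes e_1,e_1\otimes e_2,e_2\otimes e_1,e_2\otimes e_2$ with matrix elements $R^{ij}_{kl}=\langle e_i\otimes e_j,R(e_k\otimes e_l)\rangle$, is identified with $\sum R^{ij}_{kl}S_iS_jS_l^*S_k^*\in\mathcal{F}_2^2$; similarly $M_2\cong\mathcal{F}_2^1$ via $E_{ij}\mapsto S_iS_j^*$. A unitary $u\in\mathcal{O}_2$ defines the unital endomorphism $\lambda_u$ of $\mathcal{O}_2$ with $\lambda_u(S_i)=uS_i$. $\varphi(x)=\sum_iS_ixS_i^*$ is the canonical endomorphism, restricting to the shift $x\mapsto1\otimes x$ on $\mathcal{F}_2\cong M_2\otimes M_2\otimes\cdots$. $\sigma_0=1$ and $\sigma_1=\begin{pmatrix}0&1\\1&0\end{pmatrix}$, $\sigma_2=\begin{pmatrix}0&-i\\i&0\end{pmatrix}$, $\sigma_3=\begin{pmatrix}1&0\\0&-1\end{pmatrix}$ are the standard Pauli matrices in $M_2\cong\mathcal{F}_2^1$. $\mathcal{N}$ is the weak closure of $\mathcal{F}_2$ in the GNS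 representation of its normalized trace (a II$_1$ factor), to which $\lambda_{R_4}$ extends as a normal endomorphism. $\mathcal{N}^{\lambda_{R_4}}$, $(\mathcal{F}_2^n)^{\lambda_{R_4}}$, ${}^0\mathcal{F}_2^{\lambda_{R_4}}$ denote the sets of $x$ in $\mathcal{N}$, $\mathcal{F}_2^n$, ${}^0\mathcal{F}_2$, respectively, with $\lambda_{R_4}(x)=x$, and $''$ denotes the generated von Neumann algebra. *)

(* Defs.v *)
From HB Require Import structures.
From mathcomp Require Import all_boot all_order all_algebra.
From mathcomp Require Import sesquilinear complex.
From mathcomp Require Import all_classical all_reals all_analysis.

Set Implicit Arguments.
Unset Strict Implicit.
Unset Printing Implicit Defensive.

Import Order.TTheory GRing.Theory Num.Theory.
Import numFieldNormedType.Exports.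

Local Open Scope classical_set_scope.
Local Open Scope ring_scope.

(* MathComp has no join of its algebras and its normed modules, so the norm is
   a field of its own. As in MathComp, it takes its values in the scalars, where
   0 <= z means that z is real and nonnegative. *)
HB.mixin Record Algebra_isCStar (R : realType) A of GRing.Algebra R[i] A := {
  star : A -> A;
  starK : involutive star;
  starD : forall x y : A, star (x + y) = star x + star y;
  starZ : forall (a : R[i]) (x : A), star (a *: x) = a^* *: star x;
  starM : forall x y : A, star (x * y) = star y * star x;
  cnorm : A -> R[i];
  cnorm_ge0 : forall x : A, 0 <= cnorm x;
  cnorm0_eq0 : forall x : A, cnorm x = 0 -> x = 0;
  cnormD : forall x y : A, cnorm (x + y) <= cnorm x + cnorm y;
  cnormZ : forall (a : R[i]) (x : A), cnorm (a *: x) = `|a| * cnorm x;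
  cnormM : forall x y : A, cnorm (x * y) <= cnorm x * cnorm y;
  cnorm_starM : forall x : A, cnorm (star x * x) = cnorm x ^+ 2;
  cnorm_complete : forall u : nat -> A,
    (forall eps : R[i], 0 < eps -> exists n, forall i j,
       (n <= i)%N -> (n <= j)%N -> cnorm (u i - u j) < eps) ->
    exists l : A, forall eps : R[i], 0 < eps -> exists n, forall i,
      (n <= i)%N -> cnorm (u i - l) < eps
}.

#[short(type="cstarAlgType")]
HB.structure Definition CStarAlgebra (R : realType) :=
  {A of GRing.Algebra R[i] A & Algebra_isCStar R A}.

Definition cclosure (R : realType) (A : cstarAlgType R) (B : set A) : set A :=
  [set x | forall eps : R[i], 0 < eps -> exists2 y, B y & cnorm (x - y) < eps].

Section LinearAlgebra.
Variables (K : fieldType) (V : lmodType K).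

Definition lspan (B : set V) : set V :=
  [set x | exists (m : nat) (c : 'I_m -> K) (b : 'I_m -> V),
     (forall k, B (b k)) /\ x = \sum_k c k *: b k].

(* [W] is a subspace of [V] of dimension [d]; [V] itself need not be of finite
   dimension, which excludes the library's [\dim]. *)
Definition has_dim (W : set V) (d : nat) : Prop :=
  exists b : 'I_d -> V,
    (forall c : 'I_d -> K, \sum_k c k *: b k = 0 -> forall k, c k = 0) /\
    W = [set x | exists c : 'I_d -> K, x = \sum_k c k *: b k].

End LinearAlgebra.

Section Cuntz.
Variables (R : realType) (O : cstarAlgType R).

Definition cstar_subalgebra (B : set O) : Prop :=
  [/\ B 1, (forall (a : R[i]) x y, B x -> B y -> B (a *: x + y)),
      (forall x y, B x -> B y -> B (x * y)),
      (forall x, B x -> B (star x)) & cclosure B `<=` B].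

Variable S : 'I_2 -> O.

(* By Cuntz's theorem these relations determine [O] up to an isomorphism that
   respects the generators. S_1 and S_2 are the values of [S] at 0 and 1. *)
Definition cuntz_algebra : Prop :=
  [/\ (forall i j, star (S i) * S j = (i == j)%:R),
      \sum_i S i * star (S i) = 1
    & smallest cstar_subalgebra (range S) = setT].

Definition word (mu : seq 'I_2) : O := \prod_(i <- mu) S i.

Definition F2n (n : nat) : set O :=
  lspan [set x | exists mu nu : n.-tuple 'I_2, x = word mu * star (word nu)].

Definition F2alg : set O := \bigcup_n F2n n.

Definition F2 : set O := cclosure F2alg.

(* Index in 'I_4 of e_i (x) e_j, in the order e_11, e_12, e_21, e_22. *)
Definition tens_index (i j : 'I_2) : 'I_4 := inord (2 * i + j).

Definition of_mx1 (M : 'M[R[i]]_2) : O :=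
  \sum_i \sum_j M i j *: (S i * star (S j)).

Definition of_mx2 (M : 'M[R[i]]_4) : O :=
  \sum_i \sum_j \sum_k \sum_l
    M (tens_index i j) (tens_index k l)
      *: (S i * S j * star (S l) * star (S k)).

Definition can_endo (x : O) : O := \sum_i S i * x * star (S i).

(* For unitary [u], [lam] is the endomorphism lambda_u; it is determined by [u]
   since [S] generates O. *)
Definition cuntz_endo (u : O) (lam : {lrmorphism O -> O}) : Prop :=
  (forall x, lam (star x) = star (lam x)) /\ (forall i, lam (S i) = u * S i).

(* [tau] is a functional on F; its values elsewhere are irrelevant. *)
Definition normalized_trace (F : set O) (tau : O -> R[i]) : Prop :=
  [/\ tau 1 = 1,
      (forall a x y, F x -> F y -> tau (a *: x + y) = a * tau x + tau y),
      (forall x, F x -> 0 <= tau (star x * x))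
    & (forall x y, F x -> F y -> tau (x * y) = tau (y * x))].

End Cuntz.

Section Operators.
Variables (R : realType) (H : completeNormedModType R[i]).
(* [dot] is linear in its first argument, conjugate-linear in the second. *)
Variable dot : {dot H for (@Num.conj R[i])}.

(* [dot] is positive definite by its type, H is complete for its own norm, and
   the two norms agree: H is a Hilbert space. *)
Definition hilbert_dot : Prop := forall x, dot x x = `|x| ^+ 2.

Definition bounded_op : set (H -> H) :=
  [set T | linear T /\ exists c : R[i], forall x, `|T x| <= c * `|x|].

Definition adjoint_op (T U : H -> H) : Prop :=
  forall x y, dot (T x) y = dot x (U y).

Definition wot_closure (M : set (H -> H)) : set (H -> H) :=
  [set T | bounded_op T /\
     forall (s : seq (H * H)) (eps : R[i]), 0 < eps ->
       exists2 U, M U &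
         forall p, p \in s -> `|dot (T p.1 - U p.1) p.2| < eps].

Definition von_neumann_algebra (M : set (H -> H)) : Prop :=
  [/\ M `<=` bounded_op /\ M idfun,
      (forall (a : R[i]) T U, M T -> M U -> M (fun x => a *: T x + U x)),
      (forall T U, M T -> M U -> M (T \o U)),
      (forall T U, M T -> adjoint_op T U -> M U)
    & wot_closure M `<=` M].

Definition vN_gen (M : set (H -> H)) : set (H -> H) :=
  smallest von_neumann_algebra M.

Definition square_summable (xi : nat -> H) : Prop :=
  cvgn (series (fun n => `|xi n| ^+ 2) : nat -> R[i]^o).

(* [w] restricts on M to an ultraweakly continuous functional. *)
Definition normal_functional (M : set (H -> H)) (w : (H -> H) -> R[i]) : Prop :=
  exists xi eta : nat -> H,
    [/\ square_summable xi, square_summable eta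
      & forall T, M T ->
          (series (fun n => dot (T (xi n)) (eta n)) : nat -> R[i]^o)
            @ \oo --> (w T : R[i]^o)].

(* Normality is ultraweak continuity: ultraweakly continuous functionals pull
   back to ultraweakly continuous functionals. *)
Definition normal_endo (M : set (H -> H)) (L : (H -> H) -> H -> H) : Prop :=
  [/\ (forall T, M T -> M (L T)) /\ L idfun = idfun,
      (forall (a : R[i]) T U, M T -> M U ->
         L (fun x => a *: T x + U x) = fun x => a *: L T x + L U x),
      (forall T U, M T -> M U -> L (T \o U) = L T \o L U),
      (forall T U, M T -> M U -> adjoint_op T U -> adjoint_op (L T) (L U))
    & forall w, normal_functional M w -> normal_functional M (w \o L)].

(* [pi] is a representation of F; its values elsewhere are irrelevant. *)
Definition gns_triple (O : cstarAlgType R) (F : set O) (tau : O -> R[i])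
    (pi : O -> H -> H) (Om : H) : Prop :=
  [/\ (forall x, F x -> bounded_op (pi x)) /\ pi 1 = idfun,
      (forall (a : R[i]) x y, F x -> F y ->
         pi (a *: x + y) = fun v => a *: pi x v + pi y v),
      (forall x y, F x -> F y -> pi (x * y) = pi x \o pi y),
      (forall x, F x -> adjoint_op (pi x) (pi (star x)))
    & closure [set pi x Om | x in F] = setT /\
      forall x, F x -> dot (pi x Om) Om = tau x].

End Operators.

Section Matrices.
Variable R : realType.

Definition mx_of_rows (n : nat) (rows : seq (seq R[i])) : 'M[R[i]]_n :=
  \matrix_(a < n, b < n) nth 0 (nth [::] rows a) b.

Definition pauli (i : 'I_4) : 'M[R[i]]_2 :=
  nth 0 [:: 1%:M;
            mx_of_rows 2 [:: [:: 0; 1]; [:: 1; 0]];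
            mx_of_rows 2 [:: [:: 0; - 'i]; [:: 'i; 0]];
            mx_of_rows 2 [:: [:: 1; 0]; [:: 0; -1]]] i.

Definition R4 (q : R[i]) : 'M[R[i]]_4 :=
  (q / sqrtC 2) *:
    mx_of_rows 4 [:: [::  1; 1; 0;  0];
                     [:: -1; 1; 0;  0];
                     [::  0; 0; 1; -1];
                     [::  0; 0; 1;  1]].

End Matrices.

(* Sequences i_1, ..., i_n are given as functions on nat, of which only the
   values at 1, ..., n matter. *)
Definition pauli_string (R : realType) (O : cstarAlgType R) (S : 'I_2 -> O)
    (n : nat) (i : nat -> 'I_4) : O :=
  \prod_(1 <= k < n.+1) iter k.-1 (can_endo S) (of_mx1 S (pauli R (i k))).

Definition admissible (n : nat) (i : nat -> 'I_4) : Prop :=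
  [/\ val (i n) \in [:: 0; 3]%N,
      (forall k, (2 <= k <= n)%N ->
         val (i k) \in [:: 0; 2]%N -> val (i k.-1) \in [:: 0; 3]%N)
    & (forall k, (2 <= k <= n)%N ->
         val (i k) \in [:: 1; 3]%N -> val (i k.-1) \in [:: 1; 2]%N)].

(* Main.v *)
Require Import Defs.
From HB Require Import structures.
From mathcomp Require Import all_boot all_order all_algebra.
From mathcomp Require Import sesquilinear complex ring.
From mathcomp Require Import all_classical all_reals all_analysis.

(** Let Y_k = phi^k(sigma_3 (x) sigma_2). Each Y_k is a self-adjoint unitary, Y_k and
    Y_(k+1) anticommute, all other pairs commute, and R_4 = (q / sqrt 2) (1 + i Y_0).
    Conjugation by 1 + i Y_k, suitably normalized, fixes what commutes with Y_k and
    sends x to i Y_k x when x and Y_k anticommute. Since lambda acts on F_2^n as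
    conjugation by R phi(R) ... phi^(n-1)(R), it fixes every element that commutes
    with all Y_k, and it maps Y_k to Y_(k+1) (lam_Ygen).

    Conversely (fixed_comm_Ygen), if x in F_2^n is fixed then lambda^n carries the
    commutator [x, Y_k] to [x, Y_(k+n)] = 0, because Y_(k+n) lives beyond the first n
    tensor factors; lambda being injective, [x, Y_k] = 0. So the fixed points are the
    elements that commute with all Y_k. A product of Pauli matrices commutes or
    anticommutes with Y_k according to its letters at two neighbouring places, and
    conditions (a), (b), (c) say that it commutes with all of them. The Pauli strings
    of length n are an orthonormal basis of F_2^n for the trace, and a string that
    anticommutes with Y_k is orthogonal to everything that commutes with Y_k; so the
    admissible strings are a basis of the fixed points. Read from right to left, an
    admissible string leaves two choices at each step, hence the dimension 2^n.

    For the weak closure N, let Om be the cyclic vector. An operator T in N has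
    approximants T_n in F_2^n, given by the projections of T Om to F_2^n Om. They
    converge weakly to T and are bounded in norm (approx_bounded), so that normal
    functionals converge along them (approx_normal); this plays the part of
    Kaplansky's density theorem. It follows that Lam preserves the trace of N, and
    that lambda preserves the coefficients <T Om, x Om> of a fixed T. Moving the
    commutator of x with Y_k far out by powers of lambda shows as above that these
    coefficients vanish on strings that are not admissible. Hence the approximants of
    T are themselves fixed points in some F_2^n and T is their weak limit. In
    particular N^Lam consists of the T in N that commute with all Y_k, which visibly
    is a von Neumann algebra, and it is generated by the fixed points in the F_2^n.

    All of this uses that F_2^n Om, for n in the naturals, has a dense union in the
    Hilbert space, which holds because representations of F_2 are contractive
    (star_rep_contractive). *)

Set Implicit Arguments.
Unset Strict Implicit.
Unset Printing Implicit Defensive.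

Import Order.TTheory GRing.Theory Num.Theory.
Import numFieldNormedType.Exports.

Local Open Scope classical_set_scope.
Local Open Scope ring_scope.

(** * Linear spans and involutions *)

Section Span.
Variables (K : fieldType) (V : lmodType K).
Implicit Types (B W : set V) (x y : V).

Definition linear_subspace W : Prop :=
  W 0 /\ forall a x y, W x -> W y -> W (a *: x + y).

Lemma subspace_sum W (I : Type) (r : seq I) (P : pred I) (F : I -> V) :
  linear_subspace W -> (forall i, P i -> W (F i)) -> W (\sum_(i <- r | P i) F i).
Proof.
case=> W0 WD WF; elim/big_rec: _ => // i x Pi Wx.
by rewrite -[F i]scale1r; apply: WD => //; exact: WF.
Qed.

Lemma subspaceZ W a x : linear_subspace W -> W x -> W (a *: x).
Proof. by case=> W0 WD Wx; rewrite -[_ *: _]addr0; exact: WD. Qed.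

Lemma lspan_min B W : linear_subspace W -> B `<=` W -> lspan B `<=` W.
Proof.
move=> Wlin BW x [m [c [b [Bb ->]]]]; apply: subspace_sum => // k _.
by apply: subspaceZ => //; exact: BW.
Qed.

Lemma sub_lspan B : B `<=` lspan B.
Proof.
move=> x Bx; exists 1%N, (fun=> 1), (fun=> x); split=> //.
by rewrite big_ord1 scale1r.
Qed.

Lemma lspan_subspace B : linear_subspace (lspan B).
Proof.
split; first by exists 0%N, (fun=> 0), (fun=> 0); split=> [[]//|]; rewrite big_ord0.
move=> a x y [m [c [b [Bb ->]]]] [p [d [e [Be ->]]]].
exists (m + p)%N.
exists (fun k => match fintype.split k with inl i => a * c i | inr j => d j end).
exists (fun k => match fintype.split k with inl i => b i | inr j => e j end).
split; first by move=> k; case: fintype.splitP.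
rewrite big_split_ord /= scaler_sumr; congr (_ + _); apply: eq_bigr => i _.
  by case: fintype.splitP => [j /= /val_inj ->|j /= E]; rewrite ?scalerA //;
    have := ltn_ord i; rewrite E ltnNge leq_addr.
case: fintype.splitP => [j /= E|j /= /addnI/val_inj -> //].
by have := ltn_ord j; rewrite -E ltnNge leq_addr.
Qed.

End Span.

Section Star.
Variables (R : realType) (A : cstarAlgType R).
Implicit Types x y : A.

Lemma star0 : star 0 = 0 :> A.
Proof. by have := starZ 0 (0 : A); rewrite scale0r conjC0 scale0r. Qed.

Lemma star_sum (I : Type) (r : seq I) (P : pred I) (F : I -> A) :
  star (\sum_(i <- r | P i) F i) = \sum_(i <- r | P i) star (F i).
Proof. by apply: (big_morph star); [exact: starD|exact: star0]. Qed.

Lemma starN x : star (- x) = - star x.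
Proof. by apply/eqP; rewrite -addr_eq0 -starD addNr star0. Qed.

Lemma starB x y : star (x - y) = star x - star y.
Proof. by rewrite starD starN. Qed.

Lemma star1 : star 1 = 1 :> A.
Proof. by rewrite -[LHS]mulr1 -[X in _ * X]starK -starM mulr1 starK. Qed.

Lemma starX x n : star (x ^+ n) = star x ^+ n.
Proof. by elim: n => [|n IH]; rewrite ?expr0 ?star1// exprS starM IH -exprSr. Qed.

End Star.

(** * The canonical endomorphism and the matrix algebras F_2^n *)

Section Cuntz.
Variables (R : realType) (O : cstarAlgType R) (S : 'I_2 -> O).
Hypothesis hS : cuntz_algebra S.
Local Notation C := R[i].
Local Notation phi := (can_endo S).
Local Notation F := (F2n S).

Lemma isometryS i j : star (S i) * S j = (i == j)%:R.
Proof. by case: hS. Qed.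

Lemma rangeS_sum : \sum_i S i * star (S i) = 1.
Proof. by case: hS. Qed.

Lemma can_endo_is_linear : linear phi.
Proof.
move=> a x y; rewrite /can_endo scaler_sumr -big_split /=; apply: eq_bigr => i _.
by rewrite mulrDr mulrDl -scalerAr -scalerAl.
Qed.

HB.instance Definition _ :=
  GRing.isLinear.Build C O O *:%R phi can_endo_is_linear.

Lemma can_endo1 : phi 1 = 1.
Proof. by rewrite -[RHS]rangeS_sum; apply: eq_bigr => i _; rewrite mulr1. Qed.

Lemma can_endo_star x : phi (star x) = star (phi x).
Proof.
by rewrite star_sum; apply: eq_bigr => i _; rewrite !starM starK mulrA.
Qed.

(** The relations S_j^* S_i = 0 for i <> j leave one summand of phi(x) S_i. *)
Lemma mulS_can_endo i x : S i * x = phi x * S i.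
Proof.
rewrite mulr_suml (bigD1 i) //= big1 => [|j ji]; last first.
  by rewrite -!mulrA isometryS (negbTE ji) !mulr0.
by rewrite -!mulrA isometryS eqxx mulr1 addr0.
Qed.

Lemma can_endo_mul_starS i x : star (S i) * phi x = x * star (S i).
Proof.
by rewrite -[LHS]starK starM -can_endo_star starK -mulS_can_endo starM !starK.
Qed.

Lemma can_endoM x y : phi (x * y) = phi x * phi y.
Proof.
rewrite {1}/can_endo {2}/can_endo mulr_sumr; apply: eq_bigr => i _.
by rewrite !mulrA mulS_can_endo -!mulrA.
Qed.

Lemma iter_can_endoM k x y :
  iter k phi (x * y) = iter k phi x * iter k phi y.
Proof. by elim: k => //= k ->; exact: can_endoM. Qed.

Lemma iter_can_endo1 k : iter k phi 1 = 1.
Proof. by elim: k => //= k ->; exact: can_endo1. Qed.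

Lemma iter_can_endoZ k a x : iter k phi (a *: x) = a *: iter k phi x.
Proof. by elim: k => //= k ->; rewrite linearZ. Qed.

Lemma iter_can_endoD k x y : iter k phi (x + y) = iter k phi x + iter k phi y.
Proof. by elim: k => //= k ->; rewrite linearD. Qed.

Lemma iter_can_endo_star k x : iter k phi (star x) = star (iter k phi x).
Proof. by elim: k => //= k ->; exact: can_endo_star. Qed.

Lemma corner_decomp x :
  x = \sum_i \sum_j S i * (star (S i) * x * S j) * star (S j).
Proof.
rewrite -[LHS]mulr1 -[X in X * 1]mul1r -{1 2}rangeS_sum mulr_suml mulr_suml.
apply: eq_bigr => i _; rewrite mulr_sumr; apply: eq_bigr => j _.
by rewrite !mulrA.
Qed.

Lemma F2n_subspace n : linear_subspace (F n).
Proof. exact: lspan_subspace. Qed.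

Lemma F2n_min n (W : set O) : linear_subspace W ->
  (forall mu nu : n.-tuple 'I_2, W (word S mu * star (word S nu))) -> F n `<=` W.
Proof. by move=> Wlin FW; apply: lspan_min => // _ [mu [nu ->]]. Qed.

Lemma F2n_word n (mu nu : n.-tuple 'I_2) : F n (word S mu * star (word S nu)).
Proof. by apply: sub_lspan; exists mu, nu. Qed.

Lemma F2n0P x : F 0 x <-> exists a : C, x = a *: 1.
Proof.
split.
  move: x; apply: F2n_min; last first.
    move=> mu nu; exists 1; rewrite (tuple0 mu) (tuple0 nu).
    by rewrite /word big_nil star1 mulr1 scale1r.
  split; first by exists 0; rewrite scale0r.
  by move=> a x y [b ->] [c ->]; exists (a * b + c); rewrite scalerA scalerDl.
move=> [a ->]; apply: subspaceZ; first exact: F2n_subspace.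
by have := F2n_word [tuple] [tuple]; rewrite /word big_nil star1 mulr1.
Qed.

(** Seeing F_2^(n+1) as the 2 x 2 matrices over F_2^n makes each of the closure
    properties below an induction. *)
Lemma F2nSP n x :
  F n.+1 x <-> forall i j, F n (star (S i) * x * S j).
Proof.
split.
  move=> Fx i j; move: x Fx; apply: F2n_min.
    split=> [|a x y Fx Fy].
      by rewrite mulr0 mul0r; case: (F2n_subspace n).
    rewrite mulrDr mulrDl -scalerAr -scalerAl.
    by case: (F2n_subspace n) => _; exact.
  move=> mu nu; case/tupleP: mu => k mu; case/tupleP: nu => l nu.
  rewrite /word !big_cons starM !mulrA isometryS -!mulrA isometryS.
  case: (i == k); rewrite ?mul0r ?mulr0; last by case: (F2n_subspace n).
  case: (l == j); rewrite ?mulr0 ?mul0r; last by case: (F2n_subspace n).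
  rewrite mul1r mulr1; exact: F2n_word.
move=> Fx; rewrite [x]corner_decomp.
apply: subspace_sum => [|i _]; first exact: F2n_subspace.
apply: subspace_sum => [|j _]; first exact: F2n_subspace.
move: (_ * _ * _) (Fx i j) => y; move: y; apply: F2n_min.
  split=> [|a u v Fu Fv].
    by rewrite mulr0 mul0r; case: (F2n_subspace n.+1).
  rewrite mulrDr mulrDl -scalerAr -scalerAl.
  by case: (F2n_subspace n.+1) => _; exact.
move=> mu nu; have := F2n_word [tuple of i :: mu] [tuple of j :: nu].
by rewrite /word !big_cons starM !mulrA.
Qed.

Lemma F2n_le1 n x : F n x -> F n.+1 x.
Proof.
elim: n x => [|n IH] x.
  move=> /F2n0P[a ->]; apply/F2nSP => i j; apply/F2n0P.
  exists (a * (i == j)%:R).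
  rewrite -scalerAr -scalerAl mulr1 isometryS -scalerA.
  by case: (i == j); rewrite ?scale1r ?scale0r.
by move/F2nSP => Fx; apply/F2nSP => i j; exact/IH.
Qed.

Lemma F2n_le m n x : (m <= n)%N -> F m x -> F n x.
Proof.
by move=> /subnK <-; elim: (n - m)%N => //= k IH Fx; exact/F2n_le1/IH.
Qed.

Lemma F2n_lin n a x y : F n x -> F n y -> F n (a *: x + y).
Proof. by case: (F2n_subspace n) => _; exact. Qed.

Lemma F2n1 n : F n 1.
Proof. by apply: (@F2n_le 0) => //; apply/F2n0P; exists 1; rewrite scale1r. Qed.

Lemma F2nM n x y : F n x -> F n y -> F n (x * y).
Proof.
elim: n x y => [|n IH] x y.
  move=> /F2n0P[a ->] /F2n0P[b ->]; apply/F2n0P; exists (a * b).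
  by rewrite -scalerAl mul1r scalerA.
move=> /F2nSP Fx /F2nSP Fy; apply/F2nSP => i j.
rewrite -[x]mulr1 -rangeS_sum mulr_sumr mulr_suml mulr_sumr mulr_suml.
apply: subspace_sum => [|k _]; first exact: F2n_subspace.
rewrite [X in F n X](_ : _ = star (S i) * x * S k * (star (S k) * y * S j)).
  exact: IH.
by rewrite !mulrA.
Qed.

Lemma F2n_star n x : F n x -> F n (star x).
Proof.
elim: n x => [|n IH] x.
  by move=> /F2n0P[a ->]; apply/F2n0P; exists a^*; rewrite starZ star1.
move=> /F2nSP Fx; apply/F2nSP => i j.
by rewrite -[S j]starK -!starM mulrA; exact: IH.
Qed.

Lemma F2n_can_endo n x : F n x -> F n.+1 (phi x).
Proof.
move=> Fx; apply/F2nSP => i j.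
rewrite can_endo_mul_starS -mulrA isometryS.
by case: (i == j); rewrite ?mulr1 ?mulr0 //; case: (F2n_subspace n).
Qed.

Lemma F2n_iter_can_endo n k x : F n x -> F (k + n) (iter k phi x).
Proof. by elim: k => //= k IH Fx; exact/F2n_can_endo/IH. Qed.

(** The n-fold shift moves everything past the first n tensor factors. *)
Lemma F2n_comm_shift n x y : F n x -> GRing.comm x (iter n phi y).
Proof.
elim: n x => [|n IH] x /=.
  by move=> /F2n0P[a ->]; rewrite /GRing.comm -scalerAl -scalerAr mulr1 mul1r.
move/F2nSP => Fx; rewrite [x]corner_decomp /GRing.comm mulr_suml mulr_sumr.
apply: eq_bigr => i _; rewrite mulr_suml mulr_sumr; apply: eq_bigr => j _.
rewrite !mulrA -mulS_can_endo -mulrA can_endo_mul_starS.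
by have := IH _ (Fx i j); rewrite /GRing.comm !mulrA => E; rewrite -!mulrA;
   congr (_ * _); rewrite !mulrA -E.
Qed.

Lemma of_mx1_in_F2n M : F 1 (of_mx1 S M).
Proof.
apply: subspace_sum => [|i _]; first exact: F2n_subspace.
apply: subspace_sum => [|j _]; first exact: F2n_subspace.
apply: subspaceZ; first exact: F2n_subspace.
by have := F2n_word [tuple i] [tuple j]; rewrite /word !big_cons !big_nil !mulr1.
Qed.

Lemma of_mx1M M N : of_mx1 S (M *m N) = of_mx1 S M * of_mx1 S N.
Proof.
rewrite /of_mx1 mulr_suml; apply: eq_bigr => i _.
rewrite mulr_suml.
transitivity (\sum_j \sum_k (M i k * N k j) *: (S i * star (S j))).
  by apply: eq_bigr => j _; rewrite mxE scaler_suml.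
rewrite exchange_big /=; apply: eq_bigr => k _.
rewrite mulr_sumr [RHS](bigD1 k) //= [X in _ = _ + X]big1 ?addr0 => [|l lk].
  rewrite mulr_sumr; apply: eq_bigr => j _.
  rewrite -scalerAr -scalerAl scalerA mulrC -!mulrA; congr (_ *: (_ * _)).
  by rewrite [in RHS]mulrA isometryS eqxx mul1r.
rewrite mulr_sumr big1 // => j _.
rewrite -scalerAr -scalerAl mulrA -[S i * _ * _]mulrA isometryS eq_sym.
by rewrite (negbTE lk) mulr0 mul0r !scaler0.
Qed.

Lemma of_mx1_is_linear : linear (of_mx1 S).
Proof.
move=> a M N; rewrite /of_mx1 scaler_sumr -big_split; apply: eq_bigr => i _.
rewrite /= scaler_sumr -big_split; apply: eq_bigr => j _ /=.
by rewrite !mxE scalerDl scalerA.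
Qed.

HB.instance Definition _ :=
  GRing.isLinear.Build C 'M[C]_2 O *:%R (of_mx1 S) of_mx1_is_linear.

Lemma of_mx1_1 : of_mx1 S 1%:M = 1.
Proof.
rewrite -rangeS_sum; apply: eq_bigr => i _.
rewrite (bigD1 i) //= big1 ?addr0 => [|j ji]; first by rewrite !mxE eqxx scale1r.
by rewrite !mxE eq_sym (negbTE ji) scale0r.
Qed.

Lemma of_mx1_delta i j : of_mx1 S (delta_mx i j) = S i * star (S j).
Proof.
rewrite /of_mx1 (bigD1 i) //= (bigD1 j) //= !big1 => [| k ki | k kj].
- by rewrite mxE !eqxx scale1r !addr0.
- by rewrite big1 // => l _; rewrite mxE (negbTE ki) scale0r.
- by rewrite mxE (negbTE kj) andbF scale0r.
Qed.

Lemma of_mx1_star M :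
  star (of_mx1 S M) = of_mx1 S (\matrix_(i, j) (M j i)^*).
Proof.
rewrite star_sum /of_mx1 exchange_big /=; apply: eq_bigr => i _.
rewrite star_sum; apply: eq_bigr => j _.
by rewrite mxE starZ starM starK.
Qed.

End Cuntz.

(** * Pauli matrices and their tensor products *)

Local Notation p0 := (ord0 : 'I_4).
Local Notation p1 := (@Ordinal 4 1 isT).
Local Notation p2 := (@Ordinal 4 2 isT).
Local Notation p3 := (@Ordinal 4 3 isT).

Section PauliMatrices.
Variable R : realType.
Local Notation C := R[i].

Definition anti (a b : 'I_4) : bool := [&& a != ord0, b != ord0 & a != b].

(** Up to sign the Pauli matrices multiply like the Klein four-group, whose
    symplectic form is [anti]. *)
Lemma pauli_comm a b :
  pauli R a *m pauli R b = (-1) ^+ anti a b *: (pauli R b *m pauli R a).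
Proof.
case: a => [[|[|[|[|//]]]] ?]; case: b => [[|[|[|[|//]]]] ?];
  apply/matrixP => i j; case: i => [[|[|//]] ?]; case: j => [[|[|//]] ?];
  rewrite ?mxE !big_ord_recl !big_ord0 /= ?mxE /= ?expr0 ?expr1; ring.
Qed.

Lemma pauli_sqr a : pauli R a *m pauli R a = 1%:M.
Proof.
have i2 : ('i : C) * 'i = -1 by rewrite -expr2 sqrCi.
case: a => [[|[|[|[|//]]]] ?];
  apply/matrixP => i j; case: i => [[|[|//]] ?]; case: j => [[|[|//]] ?];
  rewrite ?mxE !big_ord_recl !big_ord0 /= ?mxE /= ?mulNr ?mulrN ?i2; ring.
Qed.

Lemma pauli_adj a : (\matrix_(i, j) (pauli R a j i)^*) = pauli R a.
Proof.
case: a => [[|[|[|[|//]]]] ?];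
  apply/matrixP => i j; case: i => [[|[|//]] ?]; case: j => [[|[|//]] ?];
  rewrite ?mxE /= ?mxE /= ?conjCi ?rmorph0 ?rmorph1 ?rmorphN ?rmorph1 //=.
  by rewrite conjCi opprK.
Qed.

Lemma delta_pauli i j : exists c : 'I_4 -> C,
  delta_mx i j = \sum_a c a *: pauli R a.
Proof.
exists (fun a => nth 0 (if i == j then [:: 1; 0; 0; (-1) ^+ i]
                        else [:: 0; 1; (-1) ^+ i * 'i; 0]) a / 2).
have i2 : ('i : C) * 'i = -1 by rewrite -expr2 sqrCi.
rewrite !big_ord_recl big_ord0 addr0 /=.
apply/matrixP => k l; rewrite ![in RHS]mxE.
case: i => [[|[|//]] ?]; case: j => [[|[|//]] ?];
case: k => [[|[|//]] ?]; case: l => [[|[|//]] ?];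
  rewrite !mxE /= ?expr0 ?expr1.
all: by field: i2.
Qed.

End PauliMatrices.

Section PauliStrings.
Variables (R : realType) (O : cstarAlgType R) (S : 'I_2 -> O).
Hypothesis hS : cuntz_algebra S.
Local Notation C := R[i].
Local Notation phi := (can_endo S).
Local Notation F := (F2n S).

Definition sigma (a : 'I_4) : O := of_mx1 S (pauli R a).

Definition pstr (s : seq 'I_4) : O := foldr (fun a x => sigma a * phi x) 1 s.

Lemma sigma0 : sigma ord0 = 1.
Proof. exact: of_mx1_1. Qed.

Lemma sigma_comm a b : sigma a * sigma b = (-1) ^+ anti a b *: (sigma b * sigma a).
Proof. by rewrite -!of_mx1M // -linearZ -pauli_comm. Qed.

Lemma sigma_sqr a : sigma a * sigma a = 1.
Proof. by rewrite -of_mx1M // pauli_sqr of_mx1_1. Qed.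

Lemma sigma_star a : star (sigma a) = sigma a.
Proof. by rewrite of_mx1_star pauli_adj. Qed.

Lemma sigma_shift_comm a x : sigma a * phi x = phi x * sigma a.
Proof. exact: (@F2n_comm_shift _ _ _ hS 1 _ x (of_mx1_in_F2n _ _)). Qed.

Lemma pstr_in_F2n s : F (size s) (pstr s).
Proof.
elim: s => [|a s IH] /=; first exact: F2n1.
apply: F2nM => //; last exact: F2n_can_endo.
by apply: (@F2n_le _ _ _ hS 1); last exact: of_mx1_in_F2n.
Qed.

Lemma pstr_unitary s : star (pstr s) * pstr s = 1 /\ pstr s * star (pstr s) = 1.
Proof.
elim: s => [|a s [IH1 IH2]] /=; first by rewrite star1 mulr1.
rewrite starM sigma_star -can_endo_star; split.
  by rewrite mulrA -[_ * _ * sigma a]mulrA sigma_sqr mulr1 -can_endoM // IH1 can_endo1.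
rewrite mulrA -[_ * _ * phi _]mulrA -can_endoM // IH2 can_endo1 // mulr1.
exact: sigma_sqr.
Qed.

(** Only the letter at place k fails to commute with the shifted matrix. Beyond its
    end a string reads as the letter 0, which stands for the identity. *)
Lemma shift_sigma_pstr k b s :
  iter k phi (sigma b) * pstr s =
  (-1) ^+ anti b (nth ord0 s k) *: (pstr s * iter k phi (sigma b)).
Proof.
elim: s k => [|a s IH] [|k] /=.
- by rewrite mulr1 mul1r /anti eqxx andbF expr0 scale1r.
- by rewrite mulr1 mul1r /anti eqxx andbF expr0 scale1r.
- by rewrite mulrA sigma_comm -scalerAl -!mulrA sigma_shift_comm.
- by rewrite mulrA -sigma_shift_comm -mulrA -can_endoM // IH linearZ /=
    can_endoM // -scalerAr mulrA.
Qed.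

(** The matrix units S_i S_j^* are combinations of Pauli matrices, so each row of
    the 2 x 2 block decomposition contributes one more letter in front. *)
Lemma pstr_span n : F n `<=` lspan [set pstr s | s in [set s | size s = n]].
Proof.
elim: n => [|n IH] x.
  move/F2n0P => [a ->]; apply: subspaceZ; first exact: lspan_subspace.
  by apply: sub_lspan; exists [::].
move=> /(F2nSP hS) Fx; rewrite (corner_decomp hS x).
apply: subspace_sum => [|i _]; first exact: lspan_subspace.
apply: subspace_sum => [|j _]; first exact: lspan_subspace.
move: (_ * x * _) (Fx i j) => y /IH.
rewrite mulS_can_endo // -mulrA -(of_mx1_delta S).
have [c ->] := delta_pauli R i j.
move: y; apply: (@lspan_min _ _ _ (fun y =>
  lspan _ (phi y * of_mx1 S (\sum_a c a *: pauli R a)))).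
  split=> [|a u v Lu Lv].
    rewrite linear0 mul0r.
    by case: (@lspan_subspace _ O [set pstr s | s in [set s | size s = n.+1]]).
  rewrite linearP mulrDl -scalerAl.
  by case: (@lspan_subspace _ O [set pstr s | s in [set s | size s = n.+1]]) => _; exact.
move=> _ [s sn <-]; rewrite linear_sum mulr_sumr.
apply: subspace_sum => [|a _]; first exact: lspan_subspace.
rewrite linearZ -scalerAr; apply: subspaceZ; first exact: lspan_subspace.
by apply: sub_lspan; exists (a :: s); rewrite /= ?sn // -sigma_shift_comm.
Qed.

(** ** The generators Y_k of the braid group representation *)

(** The shifts phi^k(sigma_3 (x) sigma_2). *)
Definition Ygen k : O := iter k phi (sigma p3) * iter k.+1 phi (sigma p2).

(** The letters a and b at places k and k+1 of a string make it anticommute with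
    Y_k. *)
Definition clash (a b : 'I_4) : bool := anti p3 a (+) anti p2 b.

Lemma can_endo_Ygen k : phi (Ygen k) = Ygen k.+1.
Proof. exact: can_endoM. Qed.

Lemma iter_can_endo_Ygen k m : iter k phi (Ygen m) = Ygen (k + m).
Proof. by elim: k => //= k ->; rewrite can_endo_Ygen. Qed.

Lemma Ygen_in_F2n k : F k.+2 (Ygen k).
Proof.
have F1 a : F 1 (sigma a) by exact: of_mx1_in_F2n.
apply: F2nM => //.
  apply: (F2n_le hS (leqnSn k.+1)); rewrite -addn1.
  by apply: (F2n_iter_can_endo hS); exact: F1.
by rewrite -addn1; apply: (F2n_iter_can_endo hS k.+1); exact: F1.
Qed.

Lemma Ygen_pstr k s :
  Ygen k * pstr s =
  (-1) ^+ clash (nth ord0 s k) (nth ord0 s k.+1) *: (pstr s * Ygen k).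
Proof.
rewrite /Ygen -mulrA (shift_sigma_pstr k.+1) -scalerAr [in LHS]mulrA shift_sigma_pstr.
by rewrite -scalerAl scalerA -signr_addb addbC -!mulrA.
Qed.

Lemma Ygen_comm_far k n x : (n <= k)%N -> F n x -> GRing.comm x (Ygen k).
Proof.
move=> nk Fx; rewrite -(addn0 k) -iter_can_endo_Ygen.
by apply: F2n_comm_shift => //; exact: F2n_le Fx.
Qed.

Lemma Ygen_sqr k : Ygen k * Ygen k = 1.
Proof.
have E : Ygen 0 * Ygen 0 = 1.
  rewrite /Ygen /= {2}sigma_shift_comm mulrA -[_ * _ * phi _]mulrA -can_endoM //.
  by rewrite sigma_sqr can_endo1 // mulr1 sigma_sqr.
by rewrite -(addn0 k) -iter_can_endo_Ygen -iter_can_endoM // E iter_can_endo1.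
Qed.

Lemma Ygen_star k : star (Ygen k) = Ygen k.
Proof.
rewrite -(addn0 k) -iter_can_endo_Ygen -iter_can_endo_star; congr (iter _ _ _).
by rewrite /Ygen /= starM -can_endo_star !sigma_star sigma_shift_comm.
Qed.

Lemma Ygen_anti k : Ygen k * Ygen k.+1 = - (Ygen k.+1 * Ygen k).
Proof.
have E : Ygen 0 * Ygen 1 = - (Ygen 1 * Ygen 0).
  have -> : Ygen 1 = pstr [:: ord0; p3; p2].
    by rewrite /= sigma0 mul1r can_endo1 // mulr1 can_endoM.
  by rewrite Ygen_pstr /clash /= expr1 scaleN1r.
rewrite -(addn0 k) -addnS -!iter_can_endo_Ygen -!iter_can_endoM // E.
by rewrite -scaleN1r iter_can_endoZ scaleN1r.
Qed.

End PauliStrings.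

(** * The endomorphism lambda_{R_4} *)

Section Braiding.
Variables (R : realType) (O : cstarAlgType R) (S : 'I_2 -> O).
Hypothesis hS : cuntz_algebra S.
Variable q : R[i].
Hypothesis hq : `|q| = 1.
Local Notation C := R[i].
Local Notation phi := (can_endo S).
Local Notation F := (F2n S).
Local Notation Y := (Ygen S).

Lemma of_mx1_tensor (A B : 'M[C]_2) :
  of_mx1 S A * phi (of_mx1 S B) =
  \sum_i \sum_j \sum_k \sum_l
    (A i k * B j l) *: (S i * S j * star (S l) * star (S k)).
Proof.
rewrite {1}/of_mx1 mulr_suml; apply: eq_bigr => i _.
rewrite exchange_big mulr_suml /=; apply: eq_bigr => k _.
rewrite -scalerAl -mulrA can_endo_mul_starS // mulrA /of_mx1.
rewrite mulr_sumr mulr_suml scaler_sumr; apply: eq_bigr => j _.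
rewrite mulr_sumr mulr_suml scaler_sumr; apply: eq_bigr => l _.
by rewrite -scalerAr -scalerAl scalerA !mulrA.
Qed.

Definition R4_scalar : C := q / sqrtC 2.

Lemma R4_scalar_norm : R4_scalar * R4_scalar^* = 2^-1.
Proof.
rewrite -normCK /R4_scalar normrM hq mul1r normfV exprVn; congr (_^-1).
by rewrite ger0_norm ?sqrtC_ge0 ?ler0n // sqrtCK.
Qed.

Definition braiding (y : O) : O := R4_scalar *: (1 + 'i *: y).

(** The two diagonal blocks of R_4 are the rotations 1 + i sigma_2 and
    1 - i sigma_2, so the off-diagonal part is i sigma_3 (x) sigma_2. *)
Lemma of_mx2_R4 : of_mx2 S (R4 q) = braiding (Y 0).
Proof.
have -> : braiding (Y 0) = R4_scalar *: (of_mx1 S 1%:M * phi (of_mx1 S 1%:M)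
    + 'i *: (of_mx1 S (pauli R p3) * phi (of_mx1 S (pauli R p2)))).
  by rewrite of_mx1_1 // can_endo1 // mulr1.
rewrite !of_mx1_tensor scaler_sumr -big_split scaler_sumr.
apply: eq_bigr => i _ /=; rewrite scaler_sumr -big_split scaler_sumr.
apply: eq_bigr => j _ /=; rewrite scaler_sumr -big_split scaler_sumr.
apply: eq_bigr => k _ /=; rewrite scaler_sumr -big_split scaler_sumr.
apply: eq_bigr => l _ /=; rewrite scalerA -scalerDl scalerA; congr (_ *: _).
have ii : ('i : C) * 'i = -1 by rewrite -expr2 sqrCi.
have tE (a b : 'I_2) : tens_index a b = (2 * a + b)%N :> nat.
  rewrite inordK //; case: a b => [[|[|//]] ?] [[|[|//]] ?] //.
rewrite /R4 !mxE !tE -/R4_scalar; congr (_ * _).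
case: i => [[|[|//]] ?]; case: j => [[|[|//]] ?];
case: k => [[|[|//]] ?]; case: l => [[|[|//]] ?]; rewrite /= ?mxE /=.
all: by ring: ii.
Qed.

Lemma braiding_star y : star y = y -> star (braiding y) = R4_scalar^* *: (1 - 'i *: y).
Proof. by move=> sy; rewrite starZ starD star1 starZ conjCi sy scaleNr. Qed.

Section Conjugation.
Variable y : O.
Hypotheses (yy : y * y = 1) (sy : star y = y).

Lemma braiding_comm x : GRing.comm x y ->
  GRing.comm x (braiding y) /\ GRing.comm x (star (braiding y)).
Proof.
move=> xy; rewrite braiding_star //.
have xi : GRing.comm x ('i *: y).
  by rewrite /GRing.comm -scalerAl -scalerAr xy.
split; rewrite /GRing.comm -scalerAl -scalerAr; congr (_ *: _).
  by apply: commrD => //; exact: commr1.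
by apply: commrB => //; exact: commr1.
Qed.

Lemma iY_sqr : ('i *: y) * ('i *: y) = -1.
Proof. by rewrite -scalerAl -scalerAr yy scalerA -expr2 sqrCi scaleN1r. Qed.

(** Moving x to the right turns 1 - i y into 1 + i y, whose square is 2 i y. *)
Lemma braiding_anti x : y * x = - (x * y) ->
  braiding y * x * star (braiding y) = 'i *: (y * x).
Proof.
move=> yx; rewrite braiding_star // -scalerAr -!scalerAl scalerA mulrC R4_scalar_norm.
have xy : x * (1 - 'i *: y) = (1 + 'i *: y) * x.
  by rewrite mulrBr mulrDl mulr1 mul1r -scalerAl yx scalerN -scalerAr.
have zz : (1 + 'i *: y) * (1 + 'i *: y) = 2%:R *: ('i *: y).
  rewrite mulrDl mul1r mulrDr mulr1 iY_sqr [1 + _]addrC addrACA subrr addr0.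
  by rewrite scaler_nat mulr2n.
rewrite -mulrA xy mulrA zz -!scalerAl [LHS]scalerA mulVf ?pnatr_eq0 //.
by rewrite scale1r.
Qed.

Lemma braiding_unitary :
  star (braiding y) * braiding y = 1 /\ braiding y * star (braiding y) = 1.
Proof.
have UU : braiding y * star (braiding y) = star (braiding y) * braiding y.
  by have /esym/braiding_comm[] := proj1 (braiding_comm (erefl : GRing.comm y y)).
suff E : braiding y * star (braiding y) = 1 by rewrite -UU E.
rewrite braiding_star // /braiding -scalerAr -!scalerAl scalerA mulrC R4_scalar_norm.
rewrite mulrDl mul1r mulrBr mulr1 iY_sqr opprK addrA subrK.
by rewrite -[1 + 1]/(1 *+ 2) -(scaler_nat 2 (1 : O)) scalerA mulVf ?pnatr_eq0 // scale1r.
Qed.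

End Conjugation.

Variable lam : {lrmorphism O -> O}.
Hypothesis hlam : cuntz_endo S (of_mx2 S (R4 q)) lam.
Local Notation Rb := (braiding (Y 0)).

Lemma lam_star x : lam (star x) = star (lam x).
Proof. by case: hlam. Qed.

Lemma lamS i : lam (S i) = Rb * S i.
Proof. by case: hlam => _ ->; rewrite of_mx2_R4. Qed.

Lemma can_endo_braiding y : phi (braiding y) = braiding (phi y).
Proof. by rewrite /braiding linearZ [X in _ *: X = _]linearD linearZ /= can_endo1. Qed.

Lemma lam_corner i j x :
  lam (S i * x * star (S j)) = Rb * (S i * lam x * star (S j)) * star Rb.
Proof. by rewrite !rmorphM /= lam_star !lamS starM !mulrA. Qed.

Lemma lam_can_endo x : lam (phi x) = Rb * phi (lam x) * star Rb.
Proof.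
rewrite {1}/can_endo linear_sum mulr_sumr mulr_suml; apply: eq_bigr => i _.
exact: lam_corner.
Qed.

(** The unitary R phi(R) ... phi^(n-1)(R), which implements lambda on F_2^n. *)
Fixpoint R4_prod n : O := if n is m.+1 then Rb * phi (R4_prod m) else 1.

(** On F_2^n the endomorphism is inner: applied to S_i x S_j^* it contributes one
    factor R for the new generators, and the factors for x are shifted when S_i is
    moved past them. *)
Lemma lam_inner n x : F n x -> lam x = R4_prod n * x * star (R4_prod n).
Proof.
elim: n x => [|n IH] x /=.
  by move=> /F2n0P[a ->]; rewrite linearZ rmorph1 star1 mulr1 mul1r.
move=> /(F2nSP hS) Fx; rewrite {1}(corner_decomp hS x).
rewrite [in RHS](corner_decomp hS x) linear_sum mulr_sumr mulr_suml.
apply: eq_bigr => i _; rewrite linear_sum mulr_sumr mulr_suml.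
apply: eq_bigr => j _ /=; rewrite lam_corner (IH _ (Fx i j)) starM -can_endo_star.
rewrite !mulrA; congr (_ * _); rewrite -!mulrA; congr (_ * _).
by rewrite -can_endo_mul_starS // !mulrA mulS_can_endo.
Qed.

Lemma R4_prod_unitary n :
  star (R4_prod n) * R4_prod n = 1 /\ R4_prod n * star (R4_prod n) = 1.
Proof.
have [U1 U2] := braiding_unitary (Ygen_sqr hS 0) (Ygen_star hS 0).
elim: n => [|n [IH1 IH2]] /=; first by rewrite star1 mulr1.
rewrite starM -can_endo_star; split.
  by rewrite mulrA -[_ * _ * Rb]mulrA U1 mulr1 -can_endoM // IH1 can_endo1.
by rewrite mulrA -[_ * _ * phi _]mulrA -can_endoM // IH2 can_endo1 // mulr1.
Qed.

Lemma braiding_in_F2n : F 2 Rb.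
Proof.
apply: subspaceZ; first exact: F2n_subspace.
rewrite addrC; apply: (F2n_lin _ (Ygen_in_F2n hS 0)); exact: F2n1.
Qed.

Lemma R4_prod_in_F2n n : F n.+1 (R4_prod n).
Proof.
elim: n => [|n IH] /=; first exact: F2n1.
apply: F2nM => //; last exact: F2n_can_endo.
by apply: F2n_le braiding_in_F2n.
Qed.

Lemma lam_F2n n x : F n x -> F n.+1 (lam x).
Proof.
move=> Fx; rewrite (lam_inner Fx); have FR := R4_prod_in_F2n n.
apply: F2nM => //; last exact: F2n_star.
by apply: F2nM => //; exact: F2n_le1.
Qed.

Lemma lam_inj_F2n n x : F n x -> lam x = 0 -> x = 0.
Proof.
move=> Fx; rewrite (lam_inner Fx) => E; have [R1 _] := R4_prod_unitary n.
have <- : star (R4_prod n) * (R4_prod n * x * star (R4_prod n)) * R4_prod n = x.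
  by rewrite !mulrA R1 mul1r -mulrA R1 mulr1.
by rewrite E mulr0 mul0r.
Qed.

(** The factors of [R4_prod n] are polynomials in the Y_k. *)
Lemma comm_Ygen_fixed n x : F n x -> (forall k, GRing.comm x (Y k)) -> lam x = x.
Proof.
move=> Fx xY; rewrite (lam_inner Fx).
suff xR j : GRing.comm x (iter j phi (R4_prod n)).
  by have := xR 0 => /= <-; rewrite -mulrA (proj2 (R4_prod_unitary n)) mulr1.
elim: n j {Fx} => [|n IH] j; first by rewrite iter_can_endo1 //; exact: commr1.
rewrite /= iter_can_endoM // -iterSr; apply: commrM; last exact: IH.
have -> : iter j phi Rb = braiding (Y j).
  by rewrite iter_can_endoZ iter_can_endoD // iter_can_endoZ iter_can_endo1 //
    iter_can_endo_Ygen // addn0.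
exact: (proj1 (braiding_comm (Ygen_star hS j) (xY j))).
Qed.

(** For k = 0 this is the braid relation: conjugating Y_0 by phi(R) gives i Y_1 Y_0,
    and conjugating that by R gives Y_1. For larger k the outer factor R of
    lambda(phi(x)) = R phi(lambda(x)) R^* commutes with the result. *)
Lemma lam_Ygen k : lam (Y k) = Y k.+1.
Proof.
have a01 := Ygen_anti hS 0.
elim: k => [|k IH].
  rewrite (lam_inner (Ygen_in_F2n hS 0)) /= can_endo1 // mulr1.
  rewrite can_endo_braiding can_endo_Ygen // starM.
  have -> : Rb * braiding (Y 1) * Y 0 * (star (braiding (Y 1)) * star Rb)
      = Rb * (braiding (Y 1) * Y 0 * star (braiding (Y 1))) * star Rb by rewrite -!mulrA.
  rewrite (braiding_anti (Ygen_sqr hS 1) (Ygen_star hS 1)); last by rewrite a01 opprK.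
  rewrite -scalerAr -scalerAl (braiding_anti (Ygen_sqr hS 0) (Ygen_star hS 0)).
    rewrite scalerA -expr2 sqrCi scaleN1r [Y 0 * _]mulrA a01 mulNr opprK -mulrA.
    by rewrite Ygen_sqr // mulr1.
  by rewrite [Y 0 * _]mulrA a01 mulNr.
rewrite -can_endo_Ygen // lam_can_endo IH can_endo_Ygen //.
have /(braiding_comm (Ygen_star hS 0))[R4_scalar _] : GRing.comm (Y k.+2) (Y 0).
  exact/esym/(Ygen_comm_far hS _ (Ygen_in_F2n hS 0)).
by rewrite -R4_scalar -mulrA (proj2 (braiding_unitary _ _)) ?mulr1 ?Ygen_sqr ?Ygen_star.
Qed.

Lemma iter_lam_Ygen m k : iter m lam (Y k) = Y (m + k).
Proof. by elim: m => //= m ->; rewrite lam_Ygen. Qed.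

Lemma iter_lamM m x y : iter m lam (x * y) = iter m lam x * iter m lam y.
Proof. by elim: m => //= m ->; rewrite rmorphM. Qed.

Lemma iter_lamB m x y : iter m lam (x - y) = iter m lam x - iter m lam y.
Proof. by elim: m => //= m ->; rewrite rmorphB. Qed.

Lemma iter_lam_F2n m n x : F n x -> F (m + n) (iter m lam x).
Proof. by elim: m => //= m IH Fx; exact/lam_F2n/IH. Qed.

(** The commutator of a fixed point x with Y_k is carried by lambda^m to that
    of x with the far away Y_(m+k), which vanishes for large m. *)
Lemma fixed_comm_Ygen n x : F n x -> lam x = x -> forall k, GRing.comm x (Y k).
Proof.
move=> Fx lx k; apply/eqP; rewrite -subr_eq0; apply/eqP.
have xm m : iter m lam x = x by elim: m => //= m ->.
have E : iter n lam (x * Y k - Y k * x) = 0.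
  rewrite iter_lamB (iter_lamM n x) (iter_lamM n (Y k)) xm iter_lam_Ygen.
  apply/eqP; rewrite subr_eq0.
  by apply/eqP; apply: (Ygen_comm_far hS _ Fx); exact: leq_addr.
have Fz : F (n + k.+2) (x * Y k - Y k * x).
  rewrite addrC -scaleN1r; have FY := F2n_le hS (leq_addl n _) (Ygen_in_F2n hS k).
  have Fx' := F2n_le hS (leq_addr k.+2 n) Fx.
  by apply: F2n_lin; exact: F2nM.
elim: n E {Fx xm} (n + k.+2)%N Fz => // m IH /= E p Fz.
by apply: (IH _ p Fz); apply: lam_inj_F2n E; exact: iter_lam_F2n Fz.
Qed.

End Braiding.

(** * Admissible strings *)

Fixpoint adm_string (s : seq 'I_4) : bool :=
  if s is a :: t then ~~ clash a (head p0 t) && adm_string t else true.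

Lemma adm_stringP s :
  reflect (forall k, ~~ clash (nth p0 s k) (nth p0 s k.+1)) (adm_string s).
Proof.
apply: (iffP idP).
  elim: s => [_ k|a s IH /= /andP[ab st] [|k]] //=; first by rewrite !nth_nil.
  exact: IH.
elim: s => //= a s IH H; rewrite -nth0 (H 0%N) /=.
by apply: IH => k; exact: (H k.+1).
Qed.

Definition adm_heads (b : 'I_4) : seq 'I_4 :=
  if anti p2 b then [:: p1; p2] else [:: p0; p3].

Lemma mem_adm_heads a b : (a \in adm_heads b) = ~~ clash a b.
Proof.
by case: a => [[|[|[|[|//]]]] ?]; case: b => [[|[|[|[|//]]]] ?].
Qed.

(** Read from right to left, an admissible string leaves two choices at each
    step, whence 2^n of them. *)
Fixpoint adm_seqs n : seq (seq 'I_4) :=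
  if n is m.+1 then [seq a :: s | s <- adm_seqs m, a <- adm_heads (head p0 s)]
  else [:: [::]].

Lemma size_adm_seqs n : size (adm_seqs n) = (2 ^ n)%N.
Proof.
elim: n => //= n IH; rewrite size_allpairs_dep.
rewrite sumnE big_map (eq_bigr (fun=> 2%N)) => [|s _].
  by rewrite big_const_seq count_predT iter_addn_0 IH expnS.
by rewrite /adm_heads; case: ifP.
Qed.

Lemma uniq_adm_seqs n : uniq (adm_seqs n).
Proof.
elim: n => //= n IH; apply: allpairs_uniq_dep => //.
  by move=> s _; rewrite /adm_heads; case: ifP.
by move=> [s a] [t b] _ _ /= [-> ->].
Qed.

Lemma mem_adm_seqs n s : (s \in adm_seqs n) = (size s == n) && adm_string s.
Proof.
elim: n s => [|n IH] [|a s] //=.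
  by apply/negP => /allpairsPdep[t [b [_ _]]].
apply/allpairsPdep/idP => [[t [b [tn bt [-> ->]]]]|].
  by move: tn bt; rewrite IH mem_adm_heads eqSS => /andP[-> ->] ->.
rewrite eqSS => /and3P[sn as_ st]; exists s, a.
by rewrite IH sn st mem_adm_heads as_.
Qed.

(** Conditions (b) and (c) for neighbouring letters. Condition (a) is the case in
    which b = 0 follows the last letter. *)
Lemma clash_admissible a b : (~~ clash a b) <->
  ((val b \in [:: 0; 2]%N -> val a \in [:: 0; 3]%N) /\
   (val b \in [:: 1; 3]%N -> val a \in [:: 1; 2]%N)).
Proof.
case: a => [[|[|[|[|//]]]] ?]; case: b => [[|[|[|[|//]]]] ?]; split => //=;
  by (split=> //; move=> /(_ isT)) || (case=> // H1 H2; try exact: H1; exact: H2).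
Qed.

Lemma admissible_adm_string n i : (0 < n)%N ->
  admissible n i <-> adm_string [seq i k | k <- iota 1 n].
Proof.
move=> n0.
have nthi k : (k < n)%N -> nth p0 [seq i k | k <- iota 1 n] k = i k.+1.
  by move=> kn; rewrite (nth_map 0%N) ?size_iota // nth_iota.
have nthn k : (n <= k)%N -> nth p0 [seq i k | k <- iota 1 n] k = p0.
  by move=> kn; rewrite nth_default // size_map size_iota.
split=> [[ha hb hc]|/adm_stringP adm].
  apply/adm_stringP => k; case: (ltngtP k.+1 n) => kn.
  - rewrite !nthi //; last exact: ltnW.
    by apply/clash_admissible; split; [apply: hb|apply: hc]; rewrite //= ltnS.
  - rewrite nthn // nthn; last exact: ltnW.
    by [].
  - have kn' : (k < n)%N by rewrite -kn.
    rewrite (nthi _ kn') kn (nthn _ (leqnn n)).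
    by apply/clash_admissible; split.
split.
- have := adm n.-1; rewrite nthi prednK // nthn // => /clash_admissible[H _].
  exact: H.
- move=> [//|k] /andP[k1 kn]; have := adm k.-1.
  rewrite !nthi prednK //; last exact: ltnW.
  by move=> /clash_admissible[].
- move=> [//|k] /andP[k1 kn]; have := adm k.-1.
  rewrite !nthi prednK //; last exact: ltnW.
  by move=> /clash_admissible[].
Qed.

Lemma pauli_stringE (R : realType) (O : cstarAlgType R) (S : 'I_2 -> O) n i :
  cuntz_algebra S -> pauli_string S n i = pstr S [seq i k | k <- iota 1 n].
Proof.
move=> hS; suff H m : \prod_(m.+1 <= k < (m + n).+1)
      iter k.-1 (can_endo S) (of_mx1 S (pauli R (i k))) =
    iter m (can_endo S) (pstr S [seq i k | k <- iota m.+1 n]) by exact: (H 0%N).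
elim: n m => [|n IH] m.
  by rewrite addn0 big_geq // iter_can_endo1.
rewrite big_ltn ?ltnS ?addnS ?ltnS ?leq_addr // -addSn IH /=.
by rewrite iter_can_endoM // -iterSr.
Qed.

(** * Norm closures of *-subalgebras *)

Section NormClosure.
Variables (R : realType) (A : cstarAlgType R).
Local Notation C := R[i].
Implicit Types (x y : A) (B : set A).

Lemma cnorm0 : cnorm (0 : A) = 0.
Proof. by rewrite -(scale0r (0 : A)) cnormZ normr0 mul0r. Qed.

Lemma cnormN x : cnorm (- x) = cnorm x.
Proof. by rewrite -scaleN1r cnormZ normrN1 mul1r. Qed.

Lemma cnorm_star x : cnorm (star x) = cnorm x.
Proof.
suff H y : cnorm y <= cnorm (star y).
  by apply/eqP; rewrite eq_le H -{2}(starK x) H.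
have [-> |y0] := eqVneq (cnorm y) 0; first exact: cnorm_ge0.
have y_gt0 : 0 < cnorm y by rewrite lt_def y0 cnorm_ge0.
by rewrite -(ler_pM2r y_gt0) -expr2 -cnorm_starM cnormM.
Qed.

Lemma sub_cclosure B : B `<=` cclosure B.
Proof. by move=> x Bx eps e0; exists x; rewrite // subrr cnorm0. Qed.

Lemma cclosure_closed B : cclosure (cclosure B) `<=` cclosure B.
Proof.
move=> x Bx eps e0; have e2 : 0 < eps / 2 by rewrite divr_gt0 ?ltr0n.
have [y By xy] := Bx _ e2; have [z Bz yz] := By _ e2.
exists z => //; rewrite -(subrK y x) -addrA (le_lt_trans (cnormD _ _)) //.
by rewrite [eps]splitr ltrD.
Qed.

Definition star_algebra B : Prop :=
  [/\ linear_subspace B, B 1, forall x y, B x -> B y -> B (x * y)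
    & forall x, B x -> B (star x)].

Lemma cclosure_star_algebra B : star_algebra B -> star_algebra (cclosure B).
Proof.
move=> [[B0 Blin] B1 BM Bs].
split; first split.
- exact: sub_cclosure.
- move=> a x y Bx By eps e0.
  have a0 : 0 < `|a| + 1 by rewrite ltr_wpDl.
  have e2 : 0 < eps / 2 / (`|a| + 1) by rewrite !divr_gt0 ?ltr0n.
  have e3 : 0 < eps / 2 by rewrite divr_gt0 ?ltr0n.
  have [u Bu xu] := Bx _ e2; have [v Bv yv] := By _ e3.
  exists (a *: u + v); first exact: Blin.
  rewrite opprD addrACA -scalerBr (le_lt_trans (cnormD _ _)) //.
  rewrite [eps]splitr ler_ltD // cnormZ.
  apply: (@le_trans _ _ ((`|a| + 1) * cnorm (x - u))).
    by rewrite ler_wpM2r ?cnorm_ge0 // lerDl ler01.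
  by rewrite mulrC -ler_pdivlMr // ltW.
- exact: sub_cclosure.
- move=> x y Bx By eps e0.
  have c1 (z : A) : 0 < cnorm z + 1 by rewrite ltr_wpDl ?cnorm_ge0.
  have cle (z : A) : cnorm z <= cnorm z + 1 by rewrite lerDl ler01.
  have e2 : 0 < eps / 2 / (cnorm y + 1) by rewrite !divr_gt0 ?ltr0n.
  have [u Bu xu] := Bx _ e2.
  have e3 : 0 < eps / 2 / (cnorm u + 1) by rewrite !divr_gt0 ?ltr0n.
  have [v Bv yv] := By _ e3.
  exists (u * v); first exact: BM.
  have -> : x * y - u * v = (x - u) * y + u * (y - v).
    by rewrite mulrBl mulrBr addrA subrK.
  rewrite (le_lt_trans (cnormD _ _)) // [eps]splitr ltrD //.
    rewrite (le_lt_trans (cnormM _ _)) //.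
    rewrite (le_lt_trans (ler_wpM2l (cnorm_ge0 _) (cle y))) //.
    by rewrite -ltr_pdivlMr.
  rewrite (le_lt_trans (cnormM _ _)) //.
  rewrite (le_lt_trans (ler_wpM2r (cnorm_ge0 _) (cle u))) // mulrC.
  by rewrite -ltr_pdivlMr.
- move=> x Bx eps e0; have [y By xy] := Bx _ e0.
  by exists (star y); [exact: Bs|rewrite -starB cnorm_star].
Qed.

End NormClosure.

(** * The trace *)

Section Trace.
Variables (R : realType) (O : cstarAlgType R) (S : 'I_2 -> O).
Hypothesis hS : cuntz_algebra S.
Local Notation C := R[i].
Local Notation phi := (can_endo S).
Local Notation F := (F2n S).
Local Notation Y := (Ygen S).

Lemma F2n_F2alg n x : F n x -> F2alg S x.
Proof. by move=> Fx; exists n. Qed.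

Lemma F2alg_star_algebra : star_algebra (F2alg S).
Proof.
split; first split.
- by apply: (@F2n_F2alg 0); case: (F2n_subspace S 0).
- move=> a x y [m _ Fx] [n _ Fy]; apply: (@F2n_F2alg (m + n)).
  by apply: F2n_lin; [apply: F2n_le Fx|apply: F2n_le Fy]; rewrite ?leq_addl ?leq_addr.
- by apply: (@F2n_F2alg 0); exact: F2n1.
- move=> x y [m _ Fx] [n _ Fy]; apply: (@F2n_F2alg (m + n)).
  by apply: F2nM => //; [apply: F2n_le Fx|apply: F2n_le Fy]; rewrite ?leq_addl ?leq_addr.
- by move=> x [m _ Fx]; apply: (@F2n_F2alg m); exact: F2n_star.
Qed.

Lemma F2_star_algebra : star_algebra (F2 S).
Proof. exact/cclosure_star_algebra/F2alg_star_algebra. Qed.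

Lemma F2n_F2 n x : F n x -> F2 S x.
Proof. by move=> /F2n_F2alg; exact: sub_cclosure. Qed.

Variable tau : O -> C.
Hypothesis htau : normalized_trace (F2 S) tau.

Lemma tau_lin a x y : F2 S x -> F2 S y -> tau (a *: x + y) = a * tau x + tau y.
Proof. by case: htau => _ + _ _; exact. Qed.

Lemma tau1 : tau 1 = 1.
Proof. by case: htau. Qed.

Lemma tauC x y : F2 S x -> F2 S y -> tau (x * y) = tau (y * x).
Proof. by case: htau => _ _ _; exact. Qed.

Lemma tau0 : tau 0 = 0.
Proof.
have F0 : F2 S 0 by case: F2_star_algebra => -[].
have := tau_lin 1 F0 F0; rewrite scale1r addr0 mul1r => /eqP.
by rewrite -subr_eq0 opprD addrA subrr add0r oppr_eq0 => /eqP.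
Qed.

Lemma tauZ a x : F2 S x -> tau (a *: x) = a * tau x.
Proof.
move=> Fx; have F0 : F2 S 0 by case: F2_star_algebra => -[].
by rewrite -[_ *: _]addr0 tau_lin // tau0 addr0.
Qed.

Lemma tau_sum (I : Type) (r : seq I) (P : pred I) (G : I -> O) :
  (forall i, P i -> F2 S (G i)) ->
  tau (\sum_(i <- r | P i) G i) = \sum_(i <- r | P i) tau (G i).
Proof.
move=> FG; suff [] : F2 S (\sum_(i <- r | P i) G i) /\
  tau (\sum_(i <- r | P i) G i) = \sum_(i <- r | P i) tau (G i) by [].
elim/big_rec2: _ => [|i y x Pi [Fx <-]].
  by split; [case: F2_star_algebra => -[]|exact: tau0].
split.
  rewrite -[G i]scale1r; case: F2_star_algebra => -[_ L] _ _ _.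
  by apply: L => //; exact: FG.
by rewrite -[X in X + _]scale1r tau_lin ?mul1r //; exact: FG.
Qed.

(** Conjugating by a symmetry that anticommutes with x changes the sign of the
    trace. *)
Lemma tau_anti w x : F2 S w -> F2 S x -> w * w = 1 -> w * x = - (x * w) ->
  tau x = 0.
Proof.
move=> Fw Fx ww wx; have [_ _ FM _] := F2_star_algebra.
have E : tau x = - tau x.
  rewrite -[RHS]mulN1r -tauZ // scaleN1r -{1}[x]mulr1 -ww mulrA tauC //; last exact: FM.
  by rewrite mulrA wx mulNr -mulrA ww mulr1.
by move/eqP: E; rewrite -addr_eq0 -mulr2n mulrn_eq0 => /eqP.
Qed.

Lemma pstr_F2 s : F2 S (pstr S s).
Proof. exact: (F2n_F2 (pstr_in_F2n hS s)). Qed.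

Lemma star_pstr_shift_sigma k b s :
  iter k phi (sigma S b) * star (pstr S s) =
  (-1) ^+ anti b (nth ord0 s k) *: (star (pstr S s) * iter k phi (sigma S b)).
Proof.
have := congr1 star (shift_sigma_pstr hS k b s).
rewrite starM starZ starM -iter_can_endo_star sigma_star => ->.
by rewrite rmorph_sign scalerA -expr2 sqrr_sign scale1r.
Qed.

(** Nondegeneracy of the symplectic form [anti]. *)
Lemma pauli_separated a b : a != b -> exists c, anti c a != anti c b.
Proof.
case: a => [[|[|[|[|//]]]] ?]; case: b => [[|[|[|[|//]]]] ?] // _;
 first [by exists (@Ordinal 4 1 isT) | by exists (@Ordinal 4 2 isT)].
Qed.

(** Two distinct strings differ at some place, where some Pauli matrix commutes
    with one of the letters and anticommutes with the other. *)
Lemma pstr_orthonormal s t : size s = size t ->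
  tau (star (pstr S s) * pstr S t) = (s == t)%:R.
Proof.
move=> st; case: eqP => [<-|/eqP neq].
  by rewrite (proj1 (pstr_unitary hS s)) tau1.
have [k] : exists k, nth ord0 s k != nth ord0 t k.
  apply: contrapT => /forallNP H; move/eqP: neq; apply.
  apply: (@eq_from_nth _ ord0) => // k _.
  by apply/eqP/negPn/negP; exact: H.
move=> /pauli_separated[b sb]; set w := iter k phi (sigma S b).
have Fw : F2 S w.
  exact/(@F2n_F2 (k + 1))/F2n_iter_can_endo/of_mx1_in_F2n.
have [_ _ FM Fs] := F2_star_algebra.
apply: (@tau_anti w) => //.
- by apply: FM; [apply: Fs|]; exact: pstr_F2.
- by rewrite -iter_can_endoM // sigma_sqr // iter_can_endo1.
rewrite mulrA star_pstr_shift_sigma -scalerAl -[_ * iter _ _ _ * _]mulrA.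
rewrite shift_sigma_pstr // -scalerAr scalerA -signr_addb mulrA -/w.
by move: sb; case: (anti _ _); case: (anti _ _) => // _; rewrite expr1 scaleN1r.
Qed.

Lemma pstr_expansion n x : F n x ->
  x = \sum_(t : n.-tuple 'I_4) tau (star (pstr S t) * x) *: pstr S t.
Proof.
have [Flin _ FM Fs] := F2_star_algebra.
move=> /(pstr_span hS) Lx.
suff [] : F2 S x /\
    x = \sum_(t : n.-tuple 'I_4) tau (star (pstr S t) * x) *: pstr S t by [].
move: x Lx; apply: lspan_min.
  split.
    split; first by case: Flin.
    by rewrite big1 // => t _; rewrite mulr0 tau0 scale0r.
  move=> a x y [Fx Ex] [Fy Ey]; split; first by case: Flin => _; exact.
  rewrite {1}Ex {1}Ey scaler_sumr -big_split; apply: eq_bigr => t _ /=.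
  rewrite mulrDr -scalerAr tau_lin ?scalerDl ?scalerA //;
    by apply: FM => //; exact/Fs/pstr_F2.
move=> _ [s sn <-]; split; first exact: pstr_F2.
have sz : size s == n by exact/eqP.
rewrite (bigD1 (Tuple sz)) //= big1 ?addr0 => [|t ts].
  by rewrite pstr_orthonormal // eqxx scale1r.
rewrite pstr_orthonormal ?size_tuple ?sn //.
by rewrite (_ : (tval t == s) = false) ?scale0r //; exact/negbTE.
Qed.

Lemma Ygen_F2 k : F2 S (Y k).
Proof. exact: (F2n_F2 (Ygen_in_F2n hS k)). Qed.

(** Like the string itself, its adjoint anticommutes with Y_k, and hence so does the
    product of that adjoint with x. *)
Lemma tau_comm_clash k s x : F2 S x -> GRing.comm x (Y k) ->
  clash (nth ord0 s k) (nth ord0 s k.+1) -> tau (star (pstr S s) * x) = 0.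
Proof.
move=> Fx xY cl; have [_ _ FM Fs] := F2_star_algebra.
apply: (@tau_anti (Y k)); [exact: Ygen_F2| |exact: Ygen_sqr|].
  by apply: FM => //; exact/Fs/pstr_F2.
have := congr1 star (Ygen_pstr hS k s).
rewrite cl expr1 scaleN1r starN (starM (Y k)) (starM _ (Y k)) Ygen_star // => E.
have -> : Y k * (star (pstr S s) * x) = - (star (pstr S s) * Y k) * x.
  by rewrite E opprK mulrA.
by rewrite mulNr -!(mulrA (star (pstr S s))) xY.
Qed.

Variables (q : C) (lam : {lrmorphism O -> O}).
Hypothesis hq : `|q| = 1.
Hypothesis hlam : cuntz_endo S (of_mx2 S (R4 q)) lam.

Lemma adm_fixed s : adm_string s -> lam (pstr S s) = pstr S s.
Proof.
move=> /adm_stringP adm; apply: (comm_Ygen_fixed hS hq hlam (pstr_in_F2n hS s)) => k.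
by rewrite /GRing.comm Ygen_pstr // (negbTE (adm k)) expr0 scale1r.
Qed.

Lemma sum_adm_lspan n (c : n.-tuple 'I_4 -> C) :
  (forall t : n.-tuple 'I_4, ~~ adm_string t -> c t = 0) ->
  lspan [set pstr S s | s in [set s | s \in adm_seqs n]]
    (\sum_(t : n.-tuple 'I_4) c t *: pstr S t).
Proof.
move=> c0; apply: subspace_sum => [|t _]; first exact: lspan_subspace.
have [adm|nadm] := boolP (adm_string t); last first.
  rewrite c0 // scale0r.
  by case: (lspan_subspace [set pstr S s | s in [set s | s \in adm_seqs n]]).
apply: subspaceZ; first exact: lspan_subspace.
by apply: sub_lspan; exists (tval t); rewrite //= mem_adm_seqs size_tuple eqxx.
Qed.

Lemma fixed_lspan n x : F n x -> lam x = x ->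
  lspan [set pstr S s | s in [set s | s \in adm_seqs n]] x.
Proof.
move=> Fx lx; rewrite (pstr_expansion Fx); apply: sum_adm_lspan => t.
move=> /adm_stringP/existsNP[k /negP]; rewrite negbK => cl.
by apply: tau_comm_clash cl; [exact: F2n_F2 Fx|exact: (fixed_comm_Ygen hS hq hlam Fx lx)].
Qed.

Lemma lspan_fixed n x :
  lspan [set pstr S s | s in [set s | s \in adm_seqs n]] x -> F n x /\ lam x = x.
Proof.
move: x; apply: lspan_min.
  split; first by split; [case: (F2n_subspace S n)|exact: linear0].
  by move=> a x y [Fx lx] [Fy ly]; split; [exact: F2n_lin|rewrite linearP /= lx ly].
move=> _ [s + <-]; rewrite /= mem_adm_seqs => /andP[/eqP <- adm].
by split; [exact: pstr_in_F2n|exact: adm_fixed].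
Qed.

Lemma fixed_points_F2n n x : (1 <= n)%N -> F n x ->
  (lam x = x <->
   lspan [set y | exists2 i : nat -> 'I_4,
                    admissible n i & y = pauli_string S n i] x).
Proof.
move=> n0 Fx.
have -> : [set y | exists2 i, admissible n i & y = pauli_string S n i] =
    [set pstr S s | s in [set s | s \in adm_seqs n]].
  apply/seteqP; split=> y.
    move=> [i adm ->]; exists [seq i k | k <- iota 1 n]; last by rewrite pauli_stringE.
    rewrite /= mem_adm_seqs size_map size_iota eqxx /=; exact/admissible_adm_string.
  move=> [s + <-]; rewrite /= mem_adm_seqs => /andP[/eqP sn adm].
  have E : [seq nth ord0 s k.-1 | k <- iota 1 n] = s.
    apply: (@eq_from_nth _ ord0); rewrite size_map size_iota ?sn // => k kn.
    by rewrite (nth_map 0%N) ?size_iota // nth_iota.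
  exists (fun k => nth ord0 s k.-1); first by apply/admissible_adm_string; rewrite ?E.
  by rewrite pauli_stringE // E.
by split; [exact: fixed_lspan|case/lspan_fixed].
Qed.

Lemma dim_fixed_points n : has_dim [set x | F n x /\ lam x = x] (2 ^ n).
Proof.
have [Flin _ FM Fs] := F2_star_algebra.
pose b (k : 'I_(2 ^ n)) := nth [::] (adm_seqs n) k.
have bP k : b k \in adm_seqs n by rewrite mem_nth // size_adm_seqs.
have szb k : size (b k) = n by have := bP k; rewrite mem_adm_seqs => /andP[/eqP].
exists (fun k => pstr S (b k)); split.
  move=> c c0 j; have := congr1 (fun x => tau (star (pstr S (b j)) * x)) c0.
  have Fj : F2 S (star (pstr S (b j))) by exact/Fs/pstr_F2.
  rewrite /= mulr0 tau0 mulr_sumr tau_sum => [|k _]; last first.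
    by rewrite -scalerAr; apply: (subspaceZ _ Flin); apply: FM => //; exact: pstr_F2.
  rewrite (bigD1 j) //= big1 => [|k kj].
    rewrite addr0 -scalerAr tauZ ?pstr_orthonormal ?eqxx ?mulr1 //.
    by apply: FM => //; exact: pstr_F2.
  rewrite -scalerAr tauZ; last by apply: FM => //; exact: pstr_F2.
  rewrite pstr_orthonormal ?szb // nth_uniq ?size_adm_seqs ?uniq_adm_seqs //.
  by rewrite -val_eqE eq_sym in kj; rewrite (negbTE kj) mulr0.
apply/seteqP; split=> x.
  move=> [Fx lx]; have := fixed_lspan Fx lx; move: x {Fx lx}; apply: lspan_min.
    split; first by exists (fun=> 0); rewrite big1 // => k _; rewrite scale0r.
    move=> a x y [c ->] [d ->]; exists (fun k => a * c k + d k).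
    rewrite scaler_sumr -big_split; apply: eq_bigr => k _.
    by rewrite scalerDl scalerA.
  move=> _ [s sn <-]; have := sn; rewrite /= -index_mem size_adm_seqs => si.
  exists (fun k => (k == Ordinal si)%:R); rewrite (bigD1 (Ordinal si)) //= eqxx.
  rewrite scale1r big1 ?addr0 => [|k /negbTE ->]; last by rewrite scale0r.
  by rewrite /b /= nth_index.
move=> [c ->]; apply: lspan_fixed; apply: subspace_sum => [|k _].
  exact: lspan_subspace.
apply: subspaceZ; first exact: lspan_subspace.
by apply: sub_lspan; exists (b k); first exact: bP.
Qed.

End Trace.

(** * Neumann series *)

Section Neumann.
Variables (R : realType) (A : cstarAlgType R).
Local Notation C := R[i].
Implicit Types (x y : A) (B : set A).

Lemma ge0_real (c : C) : 0 <= c -> exists2 r : R, 0 <= r & c = r%:C%C.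
Proof.
move=> c0; have cr : c = (complex.Re c)%:C%C by rewrite RRe_real // ger0_real.
by exists (complex.Re c); rewrite // -ler0c -cr.
Qed.

Lemma gt0_real (c : C) : 0 < c -> exists2 r : R, 0 < r & c = r%:C%C.
Proof.
move=> c0; have [r r0 E] := ge0_real (ltW c0); exists r => //.
by move: c0; rewrite E ltcR.
Qed.

Lemma exp_small (r : R) (e : R) : 0 <= r -> r < 1 -> 0 < e ->
  exists n, r ^+ n < e.
Proof.
move=> r0 r1 e0; have r1' : `|r| < 1 by rewrite ger0_norm.
have /cvgrPdist_lt/(_ _ e0)[n _ /(_ n (leqnn n))] := cvg_expr r1'.
by rewrite /= sub0r normrN ger0_norm ?exprn_ge0 // => H; exists n.
Qed.

Lemma cnorm1_le : cnorm (1 : A) <= 1.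
Proof.
have [-> //|n0] := eqVneq (cnorm (1 : A)) 0.
have := cnorm_starM (1 : A); rewrite star1 mulr1 expr2 => /eqP.
by rewrite -{1}[cnorm 1]mulr1 (inj_eq (mulfI n0)) => /eqP <-.
Qed.

Lemma cnormX y n : cnorm (y ^+ n) <= cnorm y ^+ n.
Proof.
elim: n => [|n IH]; first by rewrite !expr0 cnorm1_le.
by rewrite !exprS (le_trans (cnormM _ _)) // ler_wpM2l ?cnorm_ge0.
Qed.

(** The inverse of 1 - y is the limit of the partial sums of the geometric series,
    which form a Cauchy sequence because (1 - r) |u_j - u_i| <= r^i - r^j for
    r = |y|. *)
Lemma neumann B y : star_algebra B -> cclosure B `<=` B -> B y ->
  cnorm y < 1 -> exists2 w, B w & w * (1 - y) = 1.
Proof.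
move=> [[B0 Blin] B1 BM Bs] Bcl By y1.
have [r r0 rE] := ge0_real (cnorm_ge0 y).
have r1 : r < 1 by rewrite -ltcR -rE.
pose u n : A := \sum_(k < n) y ^+ k.
have BX k : B (y ^+ k) by elim: k => [|k IH]; rewrite ?expr0 ?exprS //; exact: BM.
have Bu n : B (u n) by apply: subspace_sum.
have nX k : cnorm (y ^+ k) <= (r ^+ k)%:C%C by rewrite rmorphXn /= -rE cnormX.
have uy n : u n * (1 - y) = 1 - y ^+ n.
  elim: n => [|n IH]; first by rewrite /u big_ord0 mul0r expr0 subrr.
  by rewrite /u big_ord_recr /= mulrDl IH mulrBr mulr1 -exprSr addrA subrK.
have uu i j : (i <= j)%N ->
    (1 - r)%:C%C * cnorm (u j - u i) <= (r ^+ i - r ^+ j)%:C%C.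
  move=> /subnK <-; elim: (j - i)%N => [|k IH].
    by rewrite add0n !subrr cnorm0 mulr0.
  rewrite /u addSn big_ord_recr /= addrAC.
  have d0 : 0 <= (1 - r)%:C%C by rewrite ler0c subr_ge0 ltW.
  rewrite (le_trans (ler_wpM2l d0 (cnormD _ _))) // mulrDr.
  rewrite (le_trans (lerD IH (ler_wpM2l d0 (nX _)))) // -rmorphM -rmorphD lecR.
  by rewrite mulrBl mul1r -exprS addrA subrK.
have ucauchy : forall eps : C, 0 < eps -> exists n, forall i j,
    (n <= i)%N -> (n <= j)%N -> cnorm (u i - u j) < eps.
  move=> _ /gt0_real[e e0 ->]; have d0 : 0 < 1 - r by rewrite subr_gt0.
  have [n rn] := exp_small r0 r1 (mulr_gt0 d0 e0).
  exists n.
  have H i j : (n <= i)%N -> (i <= j)%N -> cnorm (u j - u i) < e%:C%C.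
    move=> ni ij; rewrite -(ltr_pM2l (_ : 0 < (1 - r)%:C%C)) ?ltcR //.
    rewrite (le_lt_trans (uu _ _ ij)) // -rmorphM ltcR (le_lt_trans _ rn) //.
    rewrite (@le_trans _ _ (r ^+ i)) // ?gerBl ?exprn_ge0 //.
    by apply: ler_wiXn2l => //; exact: ltW.
  move=> i j ni nj; have [ij|/ltnW ji] := leqP i j; last exact: H.
  by rewrite -cnormN opprB; exact: H.
have [w uw] := cnorm_complete u ucauchy; exists w.
  apply: Bcl => eps /uw[n /(_ n (leqnn n)) un]; exists (u n) => //.
  by rewrite -cnormN opprB.
apply/eqP; rewrite -subr_eq0; apply/eqP/cnorm0_eq0/eqP.
rewrite eq_le cnorm_ge0 andbT; apply/ler_addgt0Pr => _ /gt0_real[e e0 ->].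
rewrite add0r; set b := cnorm (1 - y) + 1.
have b0 : 0 < b by rewrite ltr_wpDl ?cnorm_ge0.
have e2 : 0 < (e%:C%C / 2) / b by rewrite !divr_gt0 ?ltr0n // ltcR.
have [n un] := uw _ e2.
have eh0 : 0 < e / 2 by rewrite divr_gt0.
have [m rm] := exp_small r0 r1 eh0.
set k := (n + m)%N.
have -> : w * (1 - y) - 1 = (w - u k) * (1 - y) - y ^+ k.
  by rewrite [in RHS]mulrBl uy opprB -addrA [_ - 1 - _]addrAC subrr sub0r.
rewrite (le_trans (cnormD _ _)) // cnormN [e]splitr rmorphD lerD //.
  rewrite (le_trans (cnormM _ _)) //.
  apply: (@le_trans _ _ (cnorm (w - u k) * b)).
    by rewrite ler_wpM2l ?cnorm_ge0 // lerDl ler01.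
  rewrite -ler_pdivlMr // -cnormN opprB ltW //.
  by rewrite rmorphM fmorphV rmorph_nat; apply: un; exact: leq_addr.
rewrite (le_trans (nX k)) // lecR (le_trans _ (ltW rm)) //.
by apply: ler_wiXn2l; rewrite ?leq_addl //; exact: ltW.
Qed.

End Neumann.

(** * Hilbert space basics *)

Section Hilbert.
Variables (R : realType) (H : completeNormedModType R[i]).
Variable dot : {dot H for (@Num.conj R[i])}.
Hypothesis hdot : hilbert_dot dot.
Local Notation C := R[i].
Implicit Types u v w : H.

Lemma dotC u v : dot u v = (dot v u)^*.
Proof. by rewrite hermC expr0 mul1r. Qed.

Lemma dotDl u v w : dot (u + v) w = dot u w + dot v w.
Proof. exact: linearDl. Qed.

Lemma dotZl a u w : dot (a *: u) w = a * dot u w.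
Proof. exact: linearZl_LR. Qed.

Lemma dotDr w u v : dot w (u + v) = dot w u + dot w v.
Proof. exact: linearDr. Qed.

Lemma dotZr a w u : dot w (a *: u) = a^* * dot w u.
Proof. exact: linearZr_LR. Qed.

Lemma dotBl u v w : dot (u - v) w = dot u w - dot v w.
Proof. exact: linearBl. Qed.

Lemma dotBr w u v : dot w (u - v) = dot w u - dot w v.
Proof. exact: linearBr. Qed.

Lemma dot0l w : dot 0 w = 0.
Proof. exact: linear0l. Qed.

Lemma dot0r w : dot w 0 = 0.
Proof. exact: linear0r. Qed.

Lemma dot_inj u v : (forall w, dot u w = dot v w) -> u = v.
Proof.
move=> E; apply/eqP; rewrite -subr_eq0 -normr_eq0 -sqrf_eq0 -hdot.
by rewrite dotBl E subrr.
Qed.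

(** The squared norm of <v, v> u - <u, v> v is nonnegative. *)
Lemma cauchy_schwarz u v : `|dot u v| <= `|u| * `|v|.
Proof.
have [-> |v0] := eqVneq v 0; first by rewrite dot0r !normr0 mulr0.
have n0 : 0 < `|v| by rewrite normr_gt0.
rewrite -(@ler_pXn2r _ 2) ?nnegrE ?mulr_ge0 //.
have d0 : 0 < `|v| ^+ 2 by rewrite exprn_gt0.
rewrite -(ler_pM2l d0) -subr_ge0.
have : 0 <= dot ((`|v| ^+ 2) *: u - dot u v *: v) ((`|v| ^+ 2) *: u - dot u v *: v).
  by rewrite hdot exprn_ge0.
rewrite dotBl !dotBr !dotZl !dotZr !hdot normCK -(dotC v u).
rewrite (CrealP (ger0_real (ltW d0))) exprMn.
set a := `|v| ^+ 2; set b := `|u| ^+ 2; set c := dot u v; set d := dot v u.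
by rewrite (_ : _ - _ = a * (b * a) - a * (c * d)) //; ring.
Qed.

Lemma norm_dot_le u (c : C) :
  0 <= c -> (forall w, `|dot u w| <= c * `|w|) -> `|u| <= c.
Proof.
move=> c0 /(_ u); rewrite hdot ger0_norm ?exprn_ge0 //.
have [-> |u0] := eqVneq u 0; first by rewrite normr0.
by rewrite expr2 ler_pM2r // normr_gt0.
Qed.

(** ** Representations are contractive *)

Definition star_rep (A : cstarAlgType R) (B : set A) (pi : A -> H -> H) : Prop :=
  [/\ (forall x, B x -> bounded_op (pi x)), pi 1 = idfun,
      (forall (a : C) x y, B x -> B y ->
         pi (a *: x + y) = fun v => a *: pi x v + pi y v),
      (forall x y, B x -> B y -> pi (x * y) = pi x \o pi y)
    & (forall x, B x -> adjoint_op dot (pi x) (pi (star x)))].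

Section Contractive.
Variables (A : cstarAlgType R) (B : set A) (pi : A -> H -> H).
Hypotheses (hB : star_algebra B) (hpi : star_rep B pi).

(** Norms take their values in the complex scalars; for infima and quotients the
    squared norm is needed as a real number. *)
Definition nsq v : R := complex.Re (dot v v).

Lemma nsqE v : dot v v = (nsq v)%:C%C.
Proof. by rewrite /nsq RRe_real // ger0_real // hdot exprn_ge0. Qed.

Lemma nsq_ge0 v : 0 <= nsq v.
Proof. by rewrite -ler0c -nsqE hdot exprn_ge0. Qed.

Lemma nsq_eq0 v : nsq v = 0 -> v = 0.
Proof.
move=> n0; apply/eqP; rewrite -normr_eq0 -sqrf_eq0 -hdot nsqE n0.
by rewrite eqxx.
Qed.

Lemma nsq_cs u v c : dot u v = c%:C%C -> c ^+ 2 <= nsq u * nsq v.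
Proof.
move=> E; rewrite -lecR rmorphXn rmorphM /= -E -!nsqE !hdot -exprMn.
have cr : dot u v \is Num.real by rewrite E complex_real.
by rewrite -(real_normK cr) ler_pXn2r ?nnegrE ?mulr_ge0 // cauchy_schwarz.
Qed.

Lemma nsq0 : nsq 0 = 0.
Proof. by rewrite /nsq dot0l. Qed.

Lemma nsq_gt0 v : v != 0 -> 0 < nsq v.
Proof.
by move=> v0; rewrite lt_def nsq_ge0 andbT; apply: contra_neq v0; exact: nsq_eq0.
Qed.

Lemma linear_fun0 (T : H -> H) : linear T -> T 0 = 0.
Proof.
by move=> Tlin; have := Tlin (-1) 0 0; rewrite !scaleN1r !addNr.
Qed.

Lemma bounded_op_nsq T : bounded_op T ->
  exists2 k : R, 0 <= k & forall v, nsq (T v) <= k * nsq v.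
Proof.
move=> [Tlin [c Tc]]; have [r r0 rE] := ge0_real (normr_ge0 c).
exists (r ^+ 2) => [|v]; first exact: exprn_ge0.
have cv : c * `|v| = `|c| * `|v|.
  by rewrite -[RHS]ger0_norm ?mulr_ge0 // normrM normr_id -normrM ger0_norm //
    (le_trans _ (Tc v)).
rewrite -lecR rmorphM rmorphXn /= -rE -!nsqE !hdot -exprMn.
by rewrite ler_pXn2r ?nnegrE ?mulr_ge0 // -cv.
Qed.

Lemma star_rep0 : pi 0 = fun=> 0.
Proof.
have [_ _ BZ _ _] := hpi; have [[B0 _] _ _ _] := hB.
have := BZ (-1) _ _ B0 B0; rewrite scaleN1r addNr => E.
by apply: funext => v; rewrite E scaleN1r addNr.
Qed.

Lemma star_repZ a x v : B x -> pi (a *: x) v = a *: pi x v.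
Proof.
move=> Bx; have [_ _ BZ _ _] := hpi; have [[B0 _] _ _ _] := hB.
by have := BZ a _ _ Bx B0; rewrite addr0 => ->; rewrite star_rep0 addr0.
Qed.

Lemma star_repB x y v : B x -> B y -> pi (x - y) v = pi x v - pi y v.
Proof.
move=> Bx By; have [_ _ BZ _ _] := hpi.
by rewrite addrC -scaleN1r (BZ _ _ _ By Bx) scaleN1r addrC.
Qed.

(** Let c be the least constant with |pi(x) v|^2 <= c |v|^2. If c - x^* x is
    invertible, then c - pi(x)^* pi(x) is bounded below, which improves the bound c.
    So c is at most D. *)
Lemma rep_bound x (D : R) : B x -> 0 <= D ->
  (forall c : R, D < c -> exists2 w, B w & w * (c%:C%C *: 1 - star x * x) = 1) ->
  forall v, nsq (pi x v) <= D * nsq v.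
Proof.
move=> Bx D0 inv v0.
have [Bb pi1 BZ BM Bs] := hpi; have [_ B1 B_M Bst] := hB.
have [Tlin _] := Bb _ Bx.
have [->|v0_neq0] := eqVneq v0 0; first by rewrite linear_fun0 // nsq0 mulr0.
set T := pi x; set E := [set c : R | forall v, nsq (T v) <= c * nsq v].
have v0_gt0 := nsq_gt0 v0_neq0.
have Elb c : E c -> 0 <= c.
  move=> /(_ v0) H1; rewrite -(ler_pM2r v0_gt0) mul0r (le_trans _ H1) //.
  exact: nsq_ge0.
have Elow : has_lbound E by exists 0 => c; exact: Elb.
have Einf : has_inf E.
  by split=> //; have [k _ Ek] := bounded_op_nsq (Bb _ Bx); exists k.
have Emin : E (inf E).
  move=> v; have [->|v_neq0] := eqVneq v 0.
    by rewrite /T linear_fun0 // nsq0 mulr0.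
  rewrite -ler_pdivrMr ?nsq_gt0 //; apply: lb_le_inf; first by case: Einf.
  by move=> c /(_ v); rewrite ler_pdivrMr ?nsq_gt0.
suff : inf E <= D.
  by move=> ED; rewrite (le_trans (Emin v0)) // ler_wpM2r // nsq_ge0.
rewrite leNgt; apply/negP => DE; set c := inf E in DE Emin.
have c0 : 0 < c by exact: le_lt_trans DE.
have [w Bw wE] := inv _ DE.
have [k k0 wk] := bounded_op_nsq (Bb _ Bw).
set Ts := pi (star x); have TTs : adjoint_op dot T Ts by exact: Bs.
have Ts_le u : nsq (Ts u) <= c * nsq u.
  have [E0|n0] := eqVneq (nsq (Ts u)) 0.
    by rewrite E0 mulr_ge0 ?nsq_ge0 ?ltW.
  have n_gt0 : 0 < nsq (Ts u) by rewrite lt_def n0 nsq_ge0.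
  rewrite -(ler_pM2l n_gt0) -expr2.
  rewrite (le_trans (@nsq_cs (T (Ts u)) u _ _)) //; first by rewrite TTs nsqE.
  by rewrite mulrCA mulrA ler_wpM2r ?nsq_ge0.
have z_le v : nsq (c%:C%C *: v - Ts (T v)) <= c * (c * nsq v - nsq (T v)).
  have cE : (c%:C%C : C)^* = c%:C%C by apply: CrealP; rewrite complex_real.
  have d1 : dot v (Ts (T v)) = (nsq (T v))%:C%C by rewrite -TTs nsqE.
  have d2 : dot (Ts (T v)) v = (nsq (T v))%:C%C.
    by rewrite dotC d1; apply: CrealP; rewrite complex_real.
  have -> : nsq (c%:C%C *: v - Ts (T v)) =
      c * (c * nsq v) - c * nsq (T v) - (c * nsq (T v) - nsq (Ts (T v))).
    apply: (@complexI R); rewrite -nsqE dotBl !dotBr !dotZl !dotZr d1 d2 !nsqE cE.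
    by rewrite !rmorphB /= !rmorphM.
  by rewrite mulrBr gerBl subr_ge0 Ts_le.
have v_le v : nsq v <= k * nsq (c%:C%C *: v - Ts (T v)).
  suff {1}-> : v = pi w (c%:C%C *: v - Ts (T v)) by [].
  have Bxx : B (star x * x) by exact/B_M/Bx/Bst.
  have Bc : B (c%:C%C *: 1) by apply: subspaceZ B1; case: hB.
  have -> : c%:C%C *: v - Ts (T v) = pi (c%:C%C *: 1 - star x * x) v.
    by rewrite star_repB // star_repZ // pi1 BM // ; exact: Bst.
  rewrite -[pi w _]/((pi w \o pi _) v) -BM ?wE ?pi1 //.
  by rewrite addrC -scaleN1r; case: hB => -[_ Bl] _ _ _; exact: Bl.
have [K0|K_neq0] := eqVneq k 0.
  have := v_le v0; rewrite K0 mul0r leNgt v0_gt0 //.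
have K_gt0 : 0 < k by rewrite lt_def K_neq0.
(* |v|^2 <= k |z|^2 <= k c (c |v|^2 - |T v|^2), where z = (c - T^* T) v. *)
have : E (c - (k * c)^-1).
  move=> v; rewrite mulrBl lerBrDr -lerBrDl mulrC ler_pdivrMr ?mulr_gt0 //.
  rewrite (le_trans (v_le v)) // (le_trans (ler_wpM2l k0 (z_le v))) //.
  by rewrite mulrA mulrC.
move=> Ec; have : c <= c - (k * c)^-1 by exact: ge_inf Elow _ Ec.
by rewrite lerBrDr gerDl leNgt invr_gt0 mulr_gt0.
Qed.

Hypothesis Bcl : cclosure B `<=` B.

(** For c > |x|^2 the Neumann series inverts c - x^* x. *)
Lemma star_rep_contractive x v : B x -> `|pi x v| <= cnorm x * `|v|.
Proof.
move=> Bx; have [Bl B1 B_M Bst] := hB.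
have [r r0 rE] := ge0_real (cnorm_ge0 x).
rewrite -(@ler_pXn2r _ 2) ?nnegrE ?mulr_ge0 ?cnorm_ge0 // exprMn -!hdot rE.
rewrite !nsqE -rmorphXn -rmorphM lecR; apply: rep_bound => // [|c rc].
  exact: exprn_ge0.
have c0 : 0 < c by rewrite (le_lt_trans _ rc) // exprn_ge0.
have cC0 : 0 < c%:C%C :> C by rewrite ltcR.
have Bxx : B (star x * x) by exact/B_M/Bx/Bst.
have [||w Bw wE] := @neumann _ _ B (c%:C%C^-1 *: (star x * x)) hB Bcl.
- exact: subspaceZ.
- rewrite cnormZ cnorm_starM rE gtr0_norm ?invr_gt0 // mulrC ltr_pdivrMr //.
  by rewrite mul1r -rmorphXn ltcR.
exists (c%:C%C^-1 *: w); first exact: subspaceZ.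
rewrite -scalerAl scalerAr scalerBr scalerA mulVf ?scale1r //.
by rewrite gt_eqF.
Qed.

End Contractive.
End Hilbert.

(** * Weak operator closures *)

Section WeakClosure.
Variables (R : realType) (H : completeNormedModType R[i]).
Variable dot : {dot H for (@Num.conj R[i])}.
Hypothesis hdot : hilbert_dot dot.
Local Notation C := R[i].
Local Notation wot := (wot_closure dot).
Implicit Types (T U : H -> H) (M : set (H -> H)) (u v w : H).

Lemma sub_wot_closure M : M `<=` @bounded_op _ H -> M `<=` wot M.
Proof.
move=> Mb T MT; split=> [|s eps e0]; first exact: Mb.
by exists T => // p _; rewrite subrr dot0l normr0.
Qed.

Lemma wot_closure_mono M1 M2 : M1 `<=` M2 -> wot M1 `<=` wot M2.
Proof.
move=> M12 T [bT MT]; split=> // s eps e0.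
by have [U /M12 MU HU] := MT s eps e0; exists U.
Qed.

Lemma wot_closure_idem M : wot (wot M) `<=` wot M.
Proof.
move=> T [bT MT]; split=> // s eps e0.
have e2 : 0 < eps / 2 by rewrite divr_gt0 ?ltr0n.
have [U [bU MU] TU] := MT s _ e2; have [V MV UV] := MU s _ e2.
exists V => // p ps; rewrite -(subrK (U p.1) (T p.1)) -addrA dotDl.
by rewrite (le_lt_trans (ler_normD _ _)) // [eps]splitr ltrD ?TU ?UV.
Qed.

(** This is how the trace property and commutation relations pass from a set of
    operators to its weak closure. *)
Lemma wot_closure_coef M T u v u' v' : wot M T ->
  (forall U, M U -> dot (U u) v = dot (U u') v') -> dot (T u) v = dot (T u') v'.
Proof.
move=> [bT MT] HU; apply/eqP; rewrite -subr_eq0 -normr_eq0 eq_le normr_ge0 andbT.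
apply/ler_addgt0Pr => eps e0; rewrite add0r.
have e2 : 0 < eps / 2 by rewrite divr_gt0 ?ltr0n.
have [U MU TU] := MT [:: (u, v); (u', v')] _ e2.
have := TU _ (mem_head _ _); have /= := TU (u', v'); rewrite !inE eqxx orbT.
move=> /(_ isT); rewrite !dotBl (HU U MU) => H1 H2.
have -> : dot (T u) v - dot (T u') v' = (dot (T u) v - dot (U u') v')
   - (dot (T u') v' - dot (U u') v') by rewrite opprB addrA subrK.
by rewrite (le_trans (ler_normB _ _)) // [eps]splitr lerD // ltW.
Qed.

Lemma bounded_op_ge0 T : bounded_op T ->
  linear T /\ exists2 c : C, 0 <= c & forall v, `|T v| <= c * `|v|.
Proof.
move=> [Tlin [c Tc]]; split=> //; exists `|c| => // v.
have cv : c * `|v| = `|c| * `|v|.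
  by rewrite -[RHS]ger0_norm ?mulr_ge0 // normrM normr_id -normrM ger0_norm //
    (le_trans _ (Tc v)).
by rewrite -cv.
Qed.

Lemma bounded_op_lin a T U : bounded_op T -> bounded_op U ->
  bounded_op (fun x => a *: T x + U x).
Proof.
move=> [Tlin [c Tc]] [Ulin [d Ud]]; split.
  move=> b u v; rewrite Tlin Ulin !scalerDr !scalerA addrACA; congr (_ + _ + _).
  by rewrite mulrC.
exists (`|a| * c + d) => v; rewrite (le_trans (ler_normD _ _)) // mulrDl lerD //.
by rewrite normrZ -mulrA ler_wpM2l.
Qed.

Lemma bounded_op_comp T U : bounded_op T -> bounded_op U -> bounded_op (T \o U).
Proof.
move=> /bounded_op_ge0[Tlin [c c0 Tc]] [Ulin [d Ud]]; split.
  by move=> b u v /=; rewrite Ulin Tlin.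
by exists (c * d) => v /=; rewrite (le_trans (Tc _)) // -mulrA ler_wpM2l.
Qed.

Lemma adjoint_opC T U : adjoint_op dot T U -> adjoint_op dot U T.
Proof. by move=> TU x y; rewrite dotC -TU -dotC. Qed.

Lemma adjoint_bounded T U : bounded_op T -> adjoint_op dot T U -> bounded_op U.
Proof.
move=> /bounded_op_ge0[Tlin [c c0 Tc]] TU; split.
  move=> a u v; apply: (dot_inj hdot) => w.
  by rewrite dotDl dotZl !(adjoint_opC TU) dotDl dotZl.
exists c => v; apply: (norm_dot_le hdot) => [|w]; first exact: mulr_ge0.
rewrite (adjoint_opC TU) (le_trans (cauchy_schwarz hdot _ _)) //.
by rewrite -mulrA mulrCA ler_wpM2l.
Qed.

Section Algebra.
Variable M : set (H -> H).
Hypothesis Mb : M `<=` @bounded_op _ H.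

Lemma wot_closure_lin a T U :
  (forall a T U, M T -> M U -> M (fun x => a *: T x + U x)) ->
  wot M T -> wot M U -> wot M (fun x => a *: T x + U x).
Proof.
move=> Mlin [bT MT] [bU MU]; split=> [|s eps e0]; first exact: bounded_op_lin.
have a0 : 0 < `|a| + 1 by rewrite ltr_wpDl.
have e2 : 0 < eps / 2 / (`|a| + 1) by rewrite !divr_gt0 ?ltr0n.
have e3 : 0 < eps / 2 by rewrite divr_gt0 ?ltr0n.
have [V MV TV] := MT s _ e2; have [W MW UW] := MU s _ e3.
exists (fun x => a *: V x + W x); first exact: Mlin.
move=> p ps; rewrite opprD addrACA -scalerBr dotDl dotZl.
rewrite (le_lt_trans (ler_normD _ _)) // [eps]splitr ler_ltD ?UW // normrM.
apply: (@le_trans _ _ ((`|a| + 1) * `|dot (T p.1 - V p.1) p.2|)).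
  by rewrite ler_wpM2r // lerDl ler01.
by rewrite mulrC -ler_pdivlMr // ltW // TV.
Qed.

Hypothesis Madj : forall T, M T -> exists2 U, M U & adjoint_op dot T U.

(** Approximate T first, by some V, on the vectors that U produces; then approximate
    U, with the adjoint of V moved to the other side. *)
Lemma wot_closure_comp T U : (forall T U, M T -> M U -> M (T \o U)) ->
  wot M T -> wot M U -> wot M (T \o U).
Proof.
move=> Mcomp [bT MT] [bU MU]; split=> [|s eps e0]; first exact: bounded_op_comp.
have e2 : 0 < eps / 2 by rewrite divr_gt0 ?ltr0n.
have [V MV TV] := MT [seq (U p.1, p.2) | p <- s] _ e2.
have [V' MV' VV'] := Madj MV.
have [W MW UW] := MU [seq (p.1, V' p.2) | p <- s] _ e2.
exists (V \o W); first exact: Mcomp.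
move=> p ps /=; rewrite -(subrK (V (U p.1)) (T _)) -addrA dotDl.
rewrite (le_lt_trans (ler_normD _ _)) // [eps]splitr ltrD //.
  by apply: (TV (U p.1, p.2)); apply/mapP; exists p.
have [Vlin _] := Mb MV.
have -> : V (U p.1) - V (W p.1) = V (U p.1 - W p.1).
  by rewrite addrC -scaleN1r -Vlin scaleN1r addrC.
by rewrite VV'; apply: (UW (p.1, V' p.2)); apply/mapP; exists p.
Qed.

Lemma wot_closure_adj T U : wot M T -> adjoint_op dot T U -> wot M U.
Proof.
move=> [bT MT] TU; split=> [|s eps e0]; first exact: adjoint_bounded TU.
have [V MV TV] := MT [seq (p.2, p.1) | p <- s] _ e0.
have [V' MV' VV'] := Madj MV; exists V' => // p ps.
have /TV : (p.2, p.1) \in [seq (p.2, p.1) | p <- s] by apply/mapP; exists p.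
rewrite /= !dotBl (adjoint_opC TU) (adjoint_opC VV') => TVp.
by rewrite -norm_conjC rmorphB /= -!dotC.
Qed.

End Algebra.
End WeakClosure.

(** * The GNS representation of the trace *)

Section GNS.
Variables (R : realType) (O : cstarAlgType R) (S : 'I_2 -> O).
Hypothesis hS : cuntz_algebra S.
Variable tau : O -> R[i].
Hypothesis htau : normalized_trace (F2 S) tau.
Variables (H : completeNormedModType R[i]) (dot : {dot H for (@Num.conj R[i])}).
Hypothesis hdot : hilbert_dot dot.
Variables (pi : O -> H -> H) (Om : H).
Hypothesis hpi : gns_triple dot (F2 S) tau pi Om.
Local Notation C := R[i].
Local Notation phi := (can_endo S).
Local Notation F := (F2n S).
Local Notation Y := (Ygen S).
Local Notation N := (wot_closure dot (pi @` F2 S)).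
Local Notation nsq := (nsq dot).
Implicit Types (T U : H -> H) (u v w : H) (x y a : O).

Lemma F2_closed : cclosure (F2 S) `<=` F2 S.
Proof. exact: cclosure_closed. Qed.

Lemma F2_lin (a : C) x y : F2 S x -> F2 S y -> F2 S (a *: x + y).
Proof. by case: (F2_star_algebra hS) => -[_ + _ _ _]; exact. Qed.

Lemma F2_1 : F2 S 1.
Proof. by case: (F2_star_algebra hS). Qed.

Lemma F2_M x y : F2 S x -> F2 S y -> F2 S (x * y).
Proof. by case: (F2_star_algebra hS) => _ _ + _; exact. Qed.

Lemma F2_star x : F2 S x -> F2 S (star x).
Proof. by case: (F2_star_algebra hS) => _ _ _; exact. Qed.

Lemma F2_X x n : F2 S x -> F2 S (x ^+ n).
Proof.
by move=> Fx; elim: n => [|n IH]; rewrite ?expr0 ?exprS; [exact: F2_1|exact: F2_M].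
Qed.

Lemma gns_rep : star_rep dot (F2 S) pi.
Proof. by case: hpi => -[? ?] ? ? ? _. Qed.

Lemma piM x y v : F2 S x -> F2 S y -> pi (x * y) v = pi x (pi y v).
Proof. by move=> Fx Fy; case: gns_rep => _ _ _ -> . Qed.

Lemma pi1 v : pi 1 v = v.
Proof. by case: gns_rep => _ ->. Qed.

Lemma pi_bounded x : F2 S x -> bounded_op (pi x).
Proof. by case: gns_rep => + _ _ _ _; exact. Qed.

Lemma pi_lin x : F2 S x -> linear (pi x).
Proof. by move=> /pi_bounded[]. Qed.

Lemma pi_funD x u v : F2 S x -> pi x (u + v) = pi x u + pi x v.
Proof. by move=> Fx; have := pi_lin Fx 1 u v; rewrite !scale1r. Qed.

Lemma pi_funB x u v : F2 S x -> pi x (u - v) = pi x u - pi x v.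
Proof.
by move=> Fx; have := pi_lin Fx (-1) v u; rewrite !scaleN1r ![- _ + _]addrC.
Qed.

Lemma piB x y v : F2 S x -> F2 S y -> pi (x - y) v = pi x v - pi y v.
Proof. by move=> Fx Fy; rewrite (star_repB gns_rep). Qed.

Lemma piDZ (a : C) x y v : F2 S x -> F2 S y -> pi (a *: x + y) v = a *: pi x v + pi y v.
Proof. by move=> Fx Fy; case: gns_rep => _ _ -> . Qed.

Lemma dot_pi x u v : F2 S x -> dot (pi x u) v = dot u (pi (star x) v).
Proof. by move=> Fx; case: gns_rep => _ _ _ _; exact. Qed.

Lemma dot_pir x u v : F2 S x -> dot u (pi x v) = dot (pi (star x) u) v.
Proof. by move=> Fx; rewrite dot_pi ?starK //; exact: F2_star. Qed.

Lemma dot_Om x y : F2 S x -> F2 S y ->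
  dot (pi x Om) (pi y Om) = tau (star y * x).
Proof.
move=> Fx Fy; rewrite dot_pir // -piM //; last exact: F2_star.
by case: hpi => _ _ _ _ [_ ->] //; apply: F2_M => //; exact: F2_star.
Qed.

Lemma norm_Om : `|Om| = 1.
Proof.
apply/eqP; rewrite -(@eqrXn2 _ 2) // expr1n -hdot -{1}(pi1 Om) -{2}(pi1 Om).
by rewrite dot_Om ?star1 ?mulr1 ?(tau1 htau) //; exact: F2_1.
Qed.

Lemma pi_contractive x v : F2 S x -> `|pi x v| <= cnorm x * `|v|.
Proof.
by move=> Fx; apply: (star_rep_contractive hdot (F2_star_algebra hS) gns_rep) => //;
  exact: F2_closed.
Qed.

(** Norm approximation in F_2 gives approximation in the Hilbert space because pi is
    contractive. *)
Lemma dense_F2alg v (eps : C) : 0 < eps ->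
  exists2 a, F2alg S a & `|v - pi a Om| < eps.
Proof.
move=> e0; have e2 : 0 < eps / 2 by rewrite divr_gt0 ?ltr0n.
have : closure [set pi x Om | x in F2 S] v by case: hpi => _ _ _ _ [-> _].
move=> /(_ _ (nbhsx_ballx _ _ e2))[_ [[x Fx <-]]].
rewrite -ball_normE /= => vx.
have [a Fa xa] := Fx _ e2; exists a => //.
have Fa' : F2 S a by exact: sub_cclosure.
rewrite -(subrK (pi x Om) v) -addrA (le_lt_trans (ler_normD _ _)) //.
rewrite [eps]splitr ltrD // -piB // (le_lt_trans (pi_contractive _ _)) //.
  by rewrite -scaleN1r addrC; exact: F2_lin.
by rewrite norm_Om mulr1.
Qed.

Lemma N_bounded T : N T -> bounded_op T.
Proof. by case. Qed.

Lemma pi_F2_bounded : pi @` F2 S `<=` @bounded_op _ H.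
Proof. by move=> _ [x Fx <-]; exact: pi_bounded. Qed.

Lemma pi_F2_adj T : (pi @` F2 S) T ->
  exists2 U, (pi @` F2 S) U & adjoint_op dot T U.
Proof.
move=> [x Fx <-]; exists (pi (star x)); first by exists (star x) => //; exact: F2_star.
by case: gns_rep => _ _ _ _; exact.
Qed.

Lemma N_pi x : F2 S x -> N (pi x).
Proof. by move=> Fx; apply: sub_wot_closure; [exact: pi_F2_bounded|exists x]. Qed.

Lemma N_comp T U : N T -> N U -> N (T \o U).
Proof.
apply: wot_closure_comp; [exact: pi_F2_bounded|exact: pi_F2_adj|].
move=> _ _ [x Fx <-] [y Fy <-]; exists (x * y); first exact: F2_M.
by case: gns_rep => _ _ _ ->.
Qed.

Lemma N_lin (a : C) T U : N T -> N U -> N (fun v => a *: T v + U v).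
Proof.
apply: wot_closure_lin => b _ _ [x Fx <-] [y Fy <-].
by exists (b *: x + y); [exact: F2_lin|case: gns_rep => _ _ ->].
Qed.

(** For T in F_2 this is the trace property, which makes right multiplication by c^*
    the adjoint of right multiplication by c; it passes to weak limits. *)
Lemma N_trace T c d : N T -> F2 S c -> F2 S d ->
  dot (T (pi c Om)) (pi d Om) = dot (T Om) (pi (d * star c) Om).
Proof.
move=> NT Fc Fd; apply: (wot_closure_coef NT) => _ [a Fa <-].
have Fcs := F2_star Fc; have Fds := F2_star Fd.
rewrite -piM // !dot_Om //; try exact: F2_M.
rewrite starM starK -mulrA [RHS](tauC htau) //; try exact: F2_M.
by rewrite mulrA (tauC htau) //; exact: F2_M.
Qed.

(** ** Approximation by finite stages *)

(** The projection of T Om to F_2^n Om, as an element of F_2^n. *)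
Definition approx T n : O :=
  \sum_(t : n.-tuple 'I_4) dot (T Om) (pi (pstr S t) Om) *: pstr S t.

Lemma approx_F2n T n : F n (approx T n).
Proof.
apply: subspace_sum => [|t _]; first exact: F2n_subspace.
apply: subspaceZ; first exact: F2n_subspace.
by have := pstr_in_F2n hS t; rewrite size_tuple.
Qed.

Lemma approx_F2 T n : F2 S (approx T n).
Proof. exact: (F2n_F2 (approx_F2n T n)). Qed.

Lemma approx_coef T n y : F n y ->
  dot (pi (approx T n) Om) (pi y Om) = dot (T Om) (pi y Om).
Proof.
move=> /(pstr_span hS) Ly.
suff [] : F2 S y /\ dot (pi (approx T n) Om) (pi y Om) = dot (T Om) (pi y Om) by [].
move: y Ly; apply: lspan_min.
  split; first by split; [case: (F2_star_algebra hS) => -[]|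
    rewrite (star_rep0 (F2_star_algebra hS) gns_rep) !dot0r].
  move=> a x y [Fx Ex] [Fy Ey]; split; first exact: F2_lin.
  by rewrite piDZ // !dotDr !dotZr Ex Ey.
move=> _ [s sn <-]; split; first exact: pstr_F2.
have Fs : F2 S (star (pstr S s)) by exact/F2_star/pstr_F2.
have sz : size s == n by exact/eqP.
rewrite dot_Om; [|exact: approx_F2|exact: pstr_F2].
rewrite mulr_sumr (tau_sum hS htau) => [|t _]; last first.
  by apply: F2_M => //; apply: subspaceZ (pstr_F2 hS t); case: (F2_star_algebra hS).
rewrite (bigD1 (Tuple sz)) //= big1 ?addr0 => [|t ts].
  rewrite -scalerAr (tauZ hS htau) ?(pstr_orthonormal hS htau) ?eqxx ?mulr1 //.
  by apply: F2_M => //; exact: pstr_F2.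
rewrite -scalerAr (tauZ hS htau); last by apply: F2_M => //; exact: pstr_F2.
rewrite (pstr_orthonormal hS htau) ?size_tuple ?sn // eq_sym.
by rewrite (_ : (tval t == s) = false) ?mulr0 //; exact/negbTE.
Qed.

(** By the trace property c moves to the other side, where d c^* is still in
    F_2^n. *)
Lemma approx_compression T n c d : N T -> F n c -> F n d ->
  dot (pi (approx T n) (pi c Om)) (pi d Om) = dot (T (pi c Om)) (pi d Om).
Proof.
move=> NT Fc Fd; have Fc2 := F2n_F2 Fc; have Fd2 := F2n_F2 Fd.
rewrite !N_trace //; last exact/N_pi/approx_F2.
by apply: approx_coef; apply: F2nM => //; exact: F2n_star.
Qed.

(** If z = A^* u and w = A z, a bound for A at z becomes one for A^* at u. *)
Lemma nsq_le_of_dot z u w (D : R) : dot z z = dot w u -> 0 <= D ->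
  nsq w <= D * nsq z -> nsq z <= D * nsq u.
Proof.
move=> E D0 wz; have [E0|n0] := eqVneq (nsq z) 0.
  by rewrite E0 mulr_ge0 ?(nsq_ge0 hdot).
have n_gt0 : 0 < nsq z by rewrite lt_def n0 (nsq_ge0 hdot).
rewrite -(ler_pM2l n_gt0) -expr2.
have Ez : dot w u = (nsq z)%:C%C by rewrite -E nsqE.
rewrite (le_trans (nsq_cs hdot Ez)) //.
by rewrite mulrCA mulrA ler_wpM2r ?(nsq_ge0 hdot).
Qed.

Lemma nsq_star_Om x : F2 S x -> nsq (pi (star x) Om) = nsq (pi x Om).
Proof.
move=> Fx; have Fs := F2_star Fx; apply: (@complexI R); rewrite -!nsqE.
by rewrite !dot_Om // starK (tauC htau).
Qed.

Lemma pow2_ratio (r K : R) : 0 <= K -> (forall k, r ^+ (2 ^ k) <= K) -> r <= 1.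
Proof.
move=> K0 rK; rewrite leNgt; apply/negP => r1.
have r0 : 0 < r by exact: lt_trans r1.
have ri0 : 0 <= r^-1 by rewrite invr_ge0 ltW.
have ri1 : r^-1 < 1 by rewrite invf_lt1.
have K1 : 0 < (K + 1)^-1 by rewrite invr_gt0 ltr_wpDl.
have [n rn] := exp_small ri0 ri1 K1.
have := rK n; rewrite leNgt => /negP; apply.
rewrite (@lt_le_trans _ _ (K + 1)) ?ltrDl ?ltr01 // -[K + 1]invrK.
rewrite -[r]invrK exprVn lef_pV2 ?posrE ?exprn_gt0 ?invr_gt0 //; last first.
  by rewrite -invr_gt0.
rewrite (le_trans _ (ltW rn)) //; apply: ler_wiXn2l => //; first exact: ltW.
exact/ltnW/ltn_expl.
Qed.

(** On F_2^n Om the operator pi (approx T n) is a compression of T, which bounds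
    it there. The bound extends to all vectors: with h = b^* b, the powers of h
    satisfy |h^m a Om| = |a^* h^m Om| by the trace property, so that |h^m v| grows at
    most like D^m also for v = a Om, while Cauchy-Schwarz makes it grow at least
    like (|h v| / |v|)^m. *)
Lemma approx_bound T (D : R) n : N T -> 0 < D ->
  (forall v, nsq (T v) <= D * nsq v) ->
  forall a, F2 S a -> nsq (pi (approx T n) (pi a Om)) <= D * nsq (pi a Om).
Proof.
move=> NT D0 TD a Fa; set b := approx T n.
have Fb : F n b := approx_F2n T n; have Fb2 := F2n_F2 Fb.
have Fbs2 := F2_star Fb2; have nge0 := nsq_ge0 hdot.
have b_le c : F n c -> nsq (pi b (pi c Om)) <= D * nsq (pi c Om).
  move=> Fc; have Fc2 := F2n_F2 Fc; apply: le_trans (TD _).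
  rewrite -[leRHS]mul1r; apply: (@nsq_le_of_dot _ _ (pi b (pi c Om))) => //.
    have := approx_compression NT Fc (F2nM hS Fb Fc).
    rewrite -/b (piM Om Fb2 Fc2) => E.
    by rewrite [in RHS]dotC -E -dotC.
  by rewrite mul1r.
have bs_le c : F n c -> nsq (pi (star b) (pi c Om)) <= D * nsq (pi c Om).
  move=> Fc; have Fc2 := F2n_F2 Fc.
  apply: (@nsq_le_of_dot _ _ (pi b (pi (star b) (pi c Om)))); last 2 first.
  - exact: ltW.
  - by rewrite -(piM Om Fbs2 Fc2); apply: b_le; apply: F2nM => //; exact: F2n_star.
  - by rewrite [RHS]dot_pi.
set h := star b * b; have Fh : F2 S h by exact: F2_M.
have FX m : F2 S (h ^+ m) by exact: F2_X.
have hX m : nsq (pi (h ^+ m) Om) <= (D ^+ 2) ^+ m.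
  have FhX k : F n (h ^+ k).
    elim: k => [|k IH]; rewrite ?expr0 ?exprS; first exact: F2n1.
    by apply: F2nM => //; apply: F2nM => //; exact: F2n_star.
  elim: m => [|m IH].
    by rewrite !expr0 pi1 -lecR -nsqE hdot norm_Om expr1n.
  rewrite (exprS h) (exprS (D ^+ 2)) (piM _ Fh (FX m)) (piM _ Fbs2 Fb2).
  rewrite -(piM _ Fb2 (FX m)).
  rewrite (le_trans (bs_le _ (F2nM hS Fb (FhX m)))) // (piM _ Fb2 (FX m)) expr2.
  rewrite -!mulrA ler_pM2l // (le_trans (b_le _ _)) //.
  by rewrite ler_pM2l.
set v := pi a Om; set nu := nsq v.
have [nu0|nu_neq0] := eqVneq nu 0.
  have -> : v = 0 by apply: (nsq_eq0 hdot).
  by rewrite (linear_fun0 (pi_lin Fb2)) nsq0 -/nu nu0 mulr0.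
have nu_gt0 : 0 < nu by rewrite lt_def nu_neq0 nge0.
pose s m := nsq (pi (h ^+ m) v).
have [K K0 aK] := bounded_op_nsq hdot (pi_bounded (F2_star Fa)).
have hs m : star (h ^+ m) = h ^+ m by rewrite starX /h starM starK.
have s_le m : s m <= K * (D ^+ 2) ^+ m.
  rewrite /s -piM // -nsq_star_Om ?starM ?hs; last exact: F2_M.
  rewrite piM //; last exact: F2_star.
  by rewrite (le_trans (aK _)) // ler_wpM2l.
have s_sqr m : s m ^+ 2 <= s (m + m)%N * nu.
  apply: (nsq_cs hdot); rewrite exprD piM // dot_pi // hs.
  exact: nsqE.
have s_ge k : s 1%N ^+ (2 ^ k) * nu <= s (2 ^ k)%N * nu ^+ (2 ^ k).
  elim: k => [|k IH]; first by rewrite expn0 !expr1.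
  rewrite -(ler_pM2r nu_gt0) expnSr mulnC mul2n -addnn.
  have -> : s 1%N ^+ (2 ^ k + 2 ^ k) * nu * nu = (s 1%N ^+ (2 ^ k) * nu) ^+ 2.
    by rewrite exprD; ring.
  have s0 j : 0 <= s j by exact: nge0.
  apply: (@le_trans _ _ ((s (2 ^ k)%N * nu ^+ (2 ^ k)) ^+ 2)).
    by rewrite ler_pXn2r ?nnegrE // mulr_ge0 ?exprn_ge0 // ltW.
  rewrite exprMn exprD -[nu ^+ _ * nu ^+ _]expr2 [leRHS]mulrAC.
  by rewrite ler_pM2r ?exprn_gt0.
have s1_le : s 1%N <= D ^+ 2 * nu.
  have D2nu : 0 < D ^+ 2 * nu by rewrite mulr_gt0 ?exprn_gt0.
  rewrite -[leRHS]mul1r -ler_pdivrMr //.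
  apply: (@pow2_ratio _ (K / nu)) => [|k]; first by rewrite divr_ge0 // ltW.
  rewrite exprMn exprVn ler_pdivlMr // mulrAC ler_pdivrMr ?exprn_gt0 //.
  rewrite (le_trans (s_ge k)) // exprMn mulrA ler_wpM2r ?s_le //.
  by rewrite exprn_ge0 // ltW.
have : nsq (pi b v) ^+ 2 <= (D * nu) ^+ 2.
  rewrite (@le_trans _ _ (s 1%N * nu)) //.
    apply: (nsq_cs hdot); rewrite expr1 piM // dot_pi // starK.
    exact: nsqE.
  by rewrite exprMn expr2 [nu ^+ 2]expr2 mulrA ler_pM2r // -expr2.
by rewrite ler_pXn2r ?nnegrE // mulr_ge0 // ltW.
Qed.

Lemma mul_lt_pad (c d e : C) : 0 <= c -> 0 <= d -> 0 < e ->
  d < e / (c + 1) -> c * d < e.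
Proof.
move=> c0 d0 e0 de; have c1 : 0 < c + 1 by rewrite ltr_wpDl.
rewrite (@le_lt_trans _ _ (d * (c + 1))) -?ltr_pdivlMr //.
by rewrite mulrC ler_wpM2l // lerDl ler01.
Qed.

Lemma approx_bounded T : N T -> exists2 c : C, 0 <= c &
  (forall v, `|T v| <= c * `|v|) /\
  forall n v, `|pi (approx T n) v| <= c * `|v|.
Proof.
move=> NT; have [k k0 kT] := bounded_op_nsq hdot (N_bounded NT).
set D := k + 1; have D0 : 0 < D by rewrite ltr_wpDl.
have DT v : nsq (T v) <= D * nsq v.
  by rewrite (le_trans (kT v)) // ler_wpM2r ?(nsq_ge0 hdot) // lerDl ler01.
pose c : C := (Num.sqrt D)%:C%C.
have c0 : 0 <= c by rewrite ler0c sqrtr_ge0.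
have cP u v : nsq u <= D * nsq v -> `|u| <= c * `|v|.
  rewrite -lecR rmorphM /= -!nsqE !hdot -{1}[D]sqr_sqrtr ?(ltW D0) //.
  by rewrite rmorphXn /= -exprMn ler_pXn2r ?nnegrE ?mulr_ge0.
exists c => //; split=> [v|n v]; first exact/cP/DT.
have Fb := approx_F2 T n.
have [blin [d d0 bd]] := bounded_op_ge0 (pi_bounded Fb).
apply/ler_addgt0Pr => e e0.
have e1 : 0 < e / (d + c + 1) by rewrite divr_gt0 // ltr_wpDl // addr_ge0.
have [a Fa va] := dense_F2alg v e1.
have Fa2 : F2 S a by exact: sub_cclosure.
rewrite -(subrK (pi a Om) v) pi_funD // (le_trans (ler_normD _ _)) //.
have H1 := cP _ _ (approx_bound n NT D0 DT Fa2).
have H2 : `|pi a Om| <= `|v| + `|v - pi a Om|.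
  by rewrite -{1}(subKr v (pi a Om)) (le_trans (ler_normB _ _)).
rewrite subrK (le_trans (lerD (bd _) (le_trans H1 (ler_wpM2l c0 H2)))) //.
rewrite mulrDr addrCA lerD2l -mulrDl ltW //.
by apply: mul_lt_pad => //; exact: addr_ge0.
Qed.

(** On vectors of F_2^n Om the coefficients of T and of its later approximants agree
    exactly; the common bound takes care of the other vectors. *)
Lemma approx_weak T u w (e : C) : N T -> 0 < e ->
  exists n0, forall n, (n0 <= n)%N -> `|dot (T u - pi (approx T n) u) w| < e.
Proof.
move=> NT e0; have [c c0 [Tc bc]] := approx_bounded NT.
have [Tlin _] := N_bounded NT.
have Xc n v : `|T v - pi (approx T n) v| <= (c + c) * `|v|.
  by rewrite (le_trans (ler_normB _ _)) // mulrDl lerD.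
have e3 : 0 < e / 2 by rewrite divr_gt0 ?ltr0n.
have cc : 0 <= c + c by exact: addr_ge0.
have k1 : 0 <= (c + c) * `|w| by exact: mulr_ge0.
have [a Fa ua] := dense_F2alg u (divr_gt0 e3 (ltr_wpDl k1 ltr01)).
have k2 : 0 <= (c + c) * `|pi a Om| by exact: mulr_ge0.
have [b Fb wb] := dense_F2alg w (divr_gt0 e3 (ltr_wpDl k2 ltr01)).
have Fa2 : F2 S a by exact: sub_cclosure.
move: (Fa) (Fb) => [m _ Fma] [p _ Fpb]; exists (m + p)%N => n mpn.
have Fna : F n a by apply: (F2n_le hS _ Fma); exact: leq_trans (leq_addr _ _) mpn.
have Fnb : F n b by apply: (F2n_le hS _ Fpb); exact: leq_trans (leq_addl _ _) mpn.
have Fn := approx_F2 T n.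
have E : dot (T u - pi (approx T n) u) w =
    dot (T (u - pi a Om) - pi (approx T n) (u - pi a Om)) w
    + dot (T (pi a Om) - pi (approx T n) (pi a Om)) (w - pi b Om).
  have Z : dot (T (pi a Om) - pi (approx T n) (pi a Om)) (pi b Om) = 0.
    by rewrite dotBl approx_compression // subrr.
  rewrite dotBr Z subr0 -dotDl.
  congr (dot _ _); rewrite pi_funB // (_ : T (u - _) = T u - T (pi a Om)).
    by rewrite opprB addrACA subrK [_ - _ - _]addrAC subrr add0r.
  by rewrite -scaleN1r addrC Tlin scaleN1r addrC.
rewrite E (le_lt_trans (ler_normD _ _)) // [e]splitr ltrD //.
  rewrite (le_lt_trans (cauchy_schwarz hdot _ _)) //.
  rewrite (le_lt_trans (ler_wpM2r _ (Xc _ _))) // mulrAC.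
  exact: mul_lt_pad.
rewrite (le_lt_trans (cauchy_schwarz hdot _ _)) //.
rewrite (le_lt_trans (ler_wpM2r _ (Xc _ _))) //.
exact: mul_lt_pad.
Qed.

(** A weak neighbourhood tests finitely many pairs of vectors, for which a common late
    approximant exists. *)
Lemma approx_wot_closure T (G : set O) : N T -> (forall n, G (approx T n)) ->
  wot_closure dot (pi @` G) T.
Proof.
move=> NT GT; split=> [|s e e0]; first exact: N_bounded.
suff [n0 Hn] : exists n0, forall n, (n0 <= n)%N -> forall p, p \in s ->
    `|dot (T p.1 - pi (approx T n) p.1) p.2| < e.
  by exists (pi (approx T n0)); [exists (approx T n0)|exact: Hn].
elim: s => [|q s [n0 Hn]]; first by exists 0%N.
have [n1 Hn1] := approx_weak q.1 q.2 NT e0.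
exists (n0 + n1)%N => n nn p; rewrite inE => /predU1P[->|ps].
  by apply: Hn1; exact: leq_trans (leq_addl _ _) nn.
by apply: Hn => //; exact: leq_trans (leq_addr _ _) nn.
Qed.

(** ** Normal functionals *)

Lemma approx_weak_sum T (xi eta : nat -> H) J : N T -> forall e : C, 0 < e ->
  exists n0, forall n, (n0 <= n)%N ->
    \sum_(0 <= j < J) `|dot (T (xi j) - pi (approx T n) (xi j)) (eta j)| < e.
Proof.
move=> NT; elim: J => [|J IH] e e0.
  by exists 0%N => n _; rewrite big_geq.
have e2 : 0 < e / 2 by rewrite divr_gt0 ?ltr0n.
have [n1 Hn1] := IH _ e2; have [n2 Hn2] := approx_weak (xi J) (eta J) NT e2.
exists (n1 + n2)%N => n nn; rewrite big_nat_recr //= [e]splitr ltrD //.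
  by apply: Hn1; exact: leq_trans (leq_addr _ _) nn.
by apply: Hn2; exact: leq_trans (leq_addl _ _) nn.
Qed.

Lemma square_summable_tail (xi : nat -> H) (e : C) : square_summable xi -> 0 < e ->
  exists J, forall p m, (J <= p)%N -> (p <= m)%N ->
    \sum_(p <= j < m) `|xi j| ^+ 2 < e.
Proof.
move=> /cvgrPdist_lt sx e0; have e2 : 0 < e / 2 by rewrite divr_gt0 ?ltr0n.
have [J _ HJ] := sx _ e2; exists J => p m Jp pm.
set l := lim _ in HJ; set u := series _ in HJ.
have um : u m = u p + \sum_(p <= j < m) `|xi j| ^+ 2.
  by rewrite /u /series /= (big_cat_nat (n := p)).
have pos : 0 <= \sum_(p <= j < m) `|xi j| ^+ 2.
  by apply: sumr_ge0 => j _; exact: exprn_ge0.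
have um' : \sum_(p <= j < m) `|xi j| ^+ 2 = u m - u p.
  by rewrite um addrAC subrr add0r.
rewrite -(ger0_norm pos) um' -(subrK l (u m)) -addrA.
rewrite (le_lt_trans (ler_normD _ _)) // [e]splitr ltrD //.
  by rewrite distrC; apply: HJ; exact: leq_trans pm.
exact: HJ.
Qed.

Lemma mul_norm_le_sqr u v : 2%:R * (`|u| * `|v|) <= `|u| ^+ 2 + `|v| ^+ 2.
Proof.
have r : `|u| - `|v| \is Num.real by rewrite rpredB // normr_real.
rewrite -subr_ge0 (_ : _ - _ = (`|u| - `|v|) ^+ 2); last by ring.
by rewrite -(real_normK r) exprn_ge0.
Qed.

(** The common bound makes the tails of the series of a normal functional uniformly
    small along the approximants; the finitely many other terms converge because the
    approximants converge weakly. *)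
Lemma approx_normal T (w : (H -> H) -> C) (e : C) :
  normal_functional dot N w -> N T -> 0 < e ->
  exists n0, forall n, (n0 <= n)%N -> `|w T - w (pi (approx T n))| < e.
Proof.
move=> [xi [eta [sx se sw]]] NT e0.
have [c c0 [Tc bc]] := approx_bounded NT.
have e4 : 0 < e / 2 / 2 by rewrite !divr_gt0 ?ltr0n.
have et : 0 < e / 2 / 2 / 2 / (c + 1) by rewrite divr_gt0 ?ltr_wpDl // divr_gt0 ?ltr0n.
have [J1 HJ1] := square_summable_tail sx et.
have [J2 HJ2] := square_summable_tail se et.
set J := (J1 + J2)%N.
have [n0 Hn0] := approx_weak_sum xi eta J NT e4.
exists n0 => n nn; set b := pi (approx T n).
have Nb : N b by exact/N_pi/approx_F2.
have /cvgrPdist_lt/(_ _ e4)[m1 _ Hm1] := sw _ NT.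
have /cvgrPdist_lt/(_ _ e4)[m2 _ Hm2] := sw _ Nb.
set m := (J + (m1 + m2))%N.
have {Hm1} := Hm1 m (leq_trans (leq_addr m2 m1) (leq_addl J _)).
have {Hm2} := Hm2 m (leq_trans (leq_addl m1 m2) (leq_addl J _)).
rewrite /=; set sb := series _ m; set sT := series _ m => Hb HT.
have -> : w T - w b = (w T - sT) + (sT - sb) + (sb - w b).
  by rewrite !addrA !subrK.
have Hb' : `|sb - w b| < e / 2 / 2 by rewrite distrC.
have tail : `|\sum_(J <= j < m) dot (T (xi j) - b (xi j)) (eta j)| < e / 2 / 2.
  have Jm : (J <= m)%N by exact: leq_addr.
  have tx := HJ1 _ _ (leq_addr J2 J1) Jm.
  have te := HJ2 _ _ (leq_addl J1 J2) Jm.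
  have le_c : \sum_(J <= j < m) `|dot (T (xi j) - b (xi j)) (eta j)| <=
      c * (\sum_(J <= j < m) `|xi j| ^+ 2 + \sum_(J <= j < m) `|eta j| ^+ 2).
    rewrite -big_split mulr_sumr; apply: ler_sum => j _ /=.
    rewrite (le_trans (cauchy_schwarz hdot _ _)) //.
    apply: (@le_trans _ _ (c * (2%:R * (`|xi j| * `|eta j|)))); last first.
      by rewrite ler_wpM2l // mul_norm_le_sqr.
    have -> : c * (2%:R * (`|xi j| * `|eta j|)) = (c + c) * `|xi j| * `|eta j|.
      by ring.
    rewrite ler_wpM2r // (le_trans (ler_normB _ _)) // mulrDl lerD //.
    exact: bc.
  rewrite (le_lt_trans (ler_norm_sum _ _ _)) // (le_lt_trans le_c) // mulrDr.
  rewrite [e / 2 / 2]splitr ltrD // mul_lt_pad ?divr_gt0 ?ltr0n //;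
    by apply: sumr_ge0 => j _; exact: exprn_ge0.
have mid : `|sT - sb| < e / 2.
  have -> : sT - sb = \sum_(0 <= j < m) dot (T (xi j) - b (xi j)) (eta j).
    rewrite /sT /sb /series /= -sumrB; apply: eq_bigr => j _.
    by rewrite dotBl.
  rewrite (big_cat_nat (n := J)) ?leq_addr //=.
  rewrite (le_lt_trans (ler_normD _ _)) // [e / 2]splitr ltrD //.
  by rewrite (le_lt_trans (ler_norm_sum _ _ _)) // Hn0.
rewrite (le_lt_trans (ler_normD _ _)) //.
have eE : e = e / 2 / 2 + e / 2 + e / 2 / 2 by field.
rewrite [ltRHS]eE ltrD //.
by rewrite (le_lt_trans (ler_normD _ _)) // ltrD.
Qed.

Lemma normal_determined T (w1 w2 : (H -> H) -> C) :
  normal_functional dot N w1 -> normal_functional dot N w2 -> N T ->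
  (forall n, w1 (pi (approx T n)) = w2 (pi (approx T n))) -> w1 T = w2 T.
Proof.
move=> n1 n2 NT E; apply/eqP; rewrite -subr_eq0 -normr_eq0 eq_le normr_ge0 andbT.
apply/ler_addgt0Pr => e e0; rewrite add0r.
have e2 : 0 < e / 2 by rewrite divr_gt0 ?ltr0n.
have [p Hp] := approx_normal n1 NT e2; have [m Hm] := approx_normal n2 NT e2.
have := Hm _ (leq_addl p m); have := Hp _ (leq_addr m p); rewrite E.
set x := w2 (pi _) => H1 H2.
rewrite -(subrK x (w1 T)) -addrA (le_trans (ler_normD _ _)) // [e]splitr.
by rewrite lerD // ltW // distrC.
Qed.

Lemma normal_coef u v : normal_functional dot N (fun T => dot (T u) v).
Proof.
exists (fun n => if n == 0%N then u else 0), (fun n => if n == 0%N then v else 0).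
have s1 (x : H) : square_summable (fun n => if n == 0%N then x else 0).
  apply: (@cvgP _ _ (`|x| ^+ 2)); apply/cvgrPdist_lt => e e0; exists 1%N => // n n0.
  rewrite /series /= big_ltn // big_nat_cond big1 ?addr0 ?subrr ?normr0 //.
  by move=> [|i] /andP[/andP[]] //= _ _ _; rewrite normr0 expr0n.
split=> // T _; apply/cvgrPdist_lt => e e0; exists 1%N => // n n0.
rewrite /series /= big_ltn // big_nat_cond big1 ?addr0 ?subrr ?normr0 //.
by move=> [|i] /andP[/andP[]] //= _ _ _; rewrite dot0r.
Qed.

(** * The fixed-point algebra *)

Variables (q : C) (lam : {lrmorphism O -> O}) (Lam : (H -> H) -> H -> H).
Hypothesis hq : `|q| = 1.
Hypothesis hlam : cuntz_endo S (of_mx2 S (R4 q)) lam.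
Hypothesis hLam : normal_endo dot N Lam.
Hypothesis hext : forall x, F2 S x -> Lam (pi x) = pi (lam x).

Lemma F2alg_F2 x : F2alg S x -> F2 S x.
Proof. exact: sub_cclosure. Qed.

Lemma lam_F2alg x : F2alg S x -> F2alg S (lam x).
Proof. by move=> [n _ Fx]; exists n.+1 => //; exact: (lam_F2n hS hlam Fx). Qed.

Lemma iter_lam_F2alg m x : F2alg S x -> F2alg S (iter m lam x).
Proof. by elim: m => //= m IH Fx; exact/lam_F2alg/IH. Qed.

Lemma tau_lam x : F2alg S x -> tau (lam x) = tau x.
Proof.
move=> [n _ Fx]; rewrite (lam_inner hS hlam Fx).
have FR := F2n_F2 (R4_prod_in_F2n hS q n); have Fx2 := F2n_F2 Fx.
have [R1 _] := R4_prod_unitary hS hq n.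
rewrite (tauC htau) //; [|exact: F2_M|exact: F2_star].
by rewrite mulrA R1 mul1r.
Qed.

Lemma dot_Om1 x : F2 S x -> dot (pi x Om) Om = tau x.
Proof. by move=> Fx; case: hpi => _ _ _ _ [_]; exact. Qed.

(** The vector state of Om and its pull-back under Lam are normal and agree on F_2^n,
    where lambda is inner and so preserves the trace; hence they agree on N. Apply
    this to x^* T. *)
Lemma coef_lam T x : N T -> Lam T = T -> F2alg S x ->
  dot (T Om) (pi (lam x) Om) = dot (T Om) (pi x Om).
Proof.
move=> NT LT Fx; have Fx2 := F2alg_F2 Fx; have Fl := F2alg_F2 (lam_F2alg Fx).
have Fs := F2_star Fx2; have [_ _ Lcomp _ Lnorm] := hLam.
have n0 := normal_coef Om Om; have n1 := Lnorm _ n0.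
have NU := N_comp (N_pi Fs) NT.
have agree n : dot (Lam (pi (approx (pi (star x) \o T) n)) Om) Om =
    dot (pi (approx (pi (star x) \o T) n) Om) Om.
  set b := approx _ n; have Fb : F2alg S b by exists n => //; exact: approx_F2n.
  have Fb2 := F2alg_F2 Fb; have Fbl := F2alg_F2 (lam_F2alg Fb).
  by rewrite hext // !dot_Om1 // tau_lam.
have := normal_determined n1 n0 NU agree.
rewrite /= Lcomp //; last exact: N_pi.
rewrite LT hext // (lam_star hlam) /= dot_pi ?starK; last exact: F2_star.
by rewrite dot_pi // starK.
Qed.

(** Since T Om is a limit of elements of the finite stages, it becomes orthogonal to
    the commutators with Y_(k+m), to which lambda^m carries those with Y_k. *)
Lemma fixed_coef_comm T x k : N T -> Lam T = T -> F2alg S x ->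
  dot (T Om) (pi (x * Y k - Y k * x) Om) = 0.
Proof.
move=> NT LT Fx; set e := x * Y k - Y k * x.
have [[_ Alin] _ AM Ast] := F2alg_star_algebra hS.
have AY j : F2alg S (Y j) by exact: (F2n_F2alg (Ygen_in_F2n hS j)).
have AC z j : F2alg S z -> F2alg S (z * Y j - Y j * z).
  by move=> Az; rewrite addrC -scaleN1r; apply: Alin; exact: AM.
have Ae : F2alg S e by exact: AC.
have coef_iter m : dot (T Om) (pi (iter m lam e) Om) = dot (T Om) (pi e Om).
  by elim: m => //= m IH; rewrite coef_lam //; exact: iter_lam_F2alg.
have norm_iter m : `|pi (iter m lam e) Om| = `|pi e Om|.
  elim: m => //= m IH; rewrite -{}IH; set z := iter m lam e.
  have Az : F2alg S z by exact: iter_lam_F2alg.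
  have Fz := F2alg_F2 Az; have Flz := F2alg_F2 (lam_F2alg Az).
  apply/eqP; rewrite -(@eqrXn2 _ 2) // -!hdot !dot_Om //.
  by rewrite -(lam_star hlam) -rmorphM tau_lam //; apply: AM => //; exact: Ast.
apply/eqP; rewrite -normr_eq0 eq_le normr_ge0 andbT.
apply/ler_addgt0Pr => d d0; rewrite add0r.
have e1 : 0 < d / (`|pi e Om| + 1) by rewrite divr_gt0 // ltr_wpDl.
have [a [n _ Fa] Ta] := dense_F2alg (T Om) e1.
have Fa2 := F2n_F2 Fa.
rewrite -(coef_iter n) -(subrK (pi a Om) (T Om)) dotDl.
have -> : dot (pi a Om) (pi (iter n lam e) Om) = 0.
  have -> : iter n lam e = iter n lam x * Y (n + k) - Y (n + k) * iter n lam x.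
    rewrite iter_lamB (iter_lamM _ _ x) (iter_lamM _ _ (Y k)).
    by rewrite (iter_lam_Ygen hS hq hlam).
  set z := iter n lam x; set y := Y (n + k).
  have Fz : F2 S z by exact/F2alg_F2/iter_lam_F2alg.
  have Fy : F2 S y by exact/F2alg_F2/AY.
  have ay : a * y = y * a by apply: (Ygen_comm_far hS _ Fa); exact: leq_addr.
  have sy : star y = y by exact: Ygen_star.
  have Fs := F2_star Fz.
  rewrite dot_Om //; last by apply/F2alg_F2/AC/iter_lam_F2alg.
  have -> : star (z * y - y * z) * a = y * (star z * a) - star z * (y * a).
    by rewrite starB (starM z) (starM y) sy mulrBl !mulrA.
  have F1 := F2_M Fy (F2_M Fs Fa2); have F2 := F2_M Fs (F2_M Fy Fa2).
  rewrite -scaleN1r addrC (tau_lin htau) // (tauC htau Fy (F2_M Fs Fa2)).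
  by rewrite -(mulrA (star z)) ay mulN1r addNr.
rewrite addr0 (le_trans (cauchy_schwarz hdot _ _)) // norm_iter mulrC ltW //.
exact: mul_lt_pad.
Qed.

Lemma clash_witness n (t : n.-tuple 'I_4) : ~~ adm_string t ->
  exists k, clash (nth ord0 t k) (nth ord0 t k.+1).
Proof. by move=> /adm_stringP/existsNP[k /negP]; rewrite negbK; exists k. Qed.

Lemma approx_adm_fixed T n :
  (forall t : n.-tuple 'I_4, ~~ adm_string t -> dot (T Om) (pi (pstr S t) Om) = 0) ->
  lam (approx T n) = approx T n.
Proof.
by move=> coef0; have [] := lspan_fixed hS hq hlam (sum_adm_lspan S coef0).
Qed.

(** If P anticommutes with Y_k then the commutator of P Y_k with Y_k is 2 P. *)
Lemma fixed_approx T n : N T -> Lam T = T -> lam (approx T n) = approx T n.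
Proof.
move=> NT LT; apply: approx_adm_fixed => t /clash_witness[k cl].
have := Ygen_pstr hS k t; rewrite cl expr1 scaleN1r => YP.
have AP : F2alg S (pstr S t * Y k).
  have [_ _ AM _] := F2alg_star_algebra hS; apply: AM.
    exact: (F2n_F2alg (pstr_in_F2n hS t)).
  exact: (F2n_F2alg (Ygen_in_F2n hS k)).
have := fixed_coef_comm k NT LT AP.
have -> : pstr S t * Y k * Y k - Y k * (pstr S t * Y k) = 2%:R *: pstr S t.
  rewrite [Y k * _]mulrA YP mulNr opprK -[_ * Y k * Y k]mulrA Ygen_sqr // mulr1.
  by rewrite scaler_nat mulr2n.
rewrite (star_repZ (F2_star_algebra hS) gns_rep) ?dotZr; last exact: pstr_F2.
by move/eqP; rewrite mulf_eq0 conjC_eq0 pnatr_eq0 /= => /eqP.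
Qed.

Definition comm_Ygens T : Prop := forall k v, T (pi (Y k) v) = pi (Y k) (T v).

(** Conjugation by Y_k changes the sign of the coefficient of a string that
    anticommutes with Y_k, so the approximants contain admissible strings only and
    are fixed; by normality so is T. *)
Lemma comm_fixed T : N T -> comm_Ygens T -> Lam T = T.
Proof.
move=> NT cT; have b_fixed n : lam (approx T n) = approx T n.
  apply: approx_adm_fixed => t /clash_witness[k cl].
  have := Ygen_pstr hS k t; rewrite cl expr1 scaleN1r => YP.
  have FY := Ygen_F2 hS k; have FP := pstr_F2 hS t.
  have sY := Ygen_star hS k.
  have E : dot (T Om) (pi (pstr S t) Om) = - dot (T Om) (pi (pstr S t) Om).
    rewrite -{1}(pi1 (T Om)) -(Ygen_sqr hS k) (piM _ FY FY) dot_pi // sY -cT.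
    rewrite -(piM _ FY FP) YP -scaleN1r.
    rewrite (star_repZ (F2_star_algebra hS) gns_rep); last exact: F2_M.
    rewrite dotZr rmorphN1 mulN1r N_trace //; last exact: F2_M.
    by rewrite sY -mulrA Ygen_sqr // mulr1.
  by move/eqP: E; rewrite -addr_eq0 -mulr2n mulrn_eq0 => /eqP.
have [_ _ _ _ Lnorm] := hLam.
apply: funext => v; apply: (dot_inj hdot) => w.
have n0 := normal_coef v w; have n1 := Lnorm _ n0.
apply: (normal_determined n1 n0 NT) => n /=.
by rewrite hext ?b_fixed //; exact: approx_F2.
Qed.

Lemma fixed_comm T : N T -> Lam T = T -> comm_Ygens T.
Proof.
move=> NT LT k v; apply: (dot_inj hdot) => w.
have FY := Ygen_F2 hS k.
pose G := [set x | F2alg S x /\ lam x = x].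
have GT n : G (approx T n).
  by split; [exists n => //; exact: approx_F2n|exact: fixed_approx].
rewrite dot_pi // Ygen_star //.
apply: (wot_closure_coef (approx_wot_closure NT GT)) => _ [x [Fx lx] <-].
have Fx2 := F2alg_F2 Fx; have [n _ Fn] := Fx.
have xY := fixed_comm_Ygen hS hq hlam Fn lx k.
by rewrite -piM // xY (piM _ FY Fx2) dot_pi // Ygen_star.
Qed.

(** Commuting with the Y_k, unlike being fixed by Lam, is visibly a weakly closed
    condition. *)
Lemma comm_von_neumann :
  von_neumann_algebra dot [set T | N T /\ comm_Ygens T].
Proof.
have lin T : N T -> linear T by move=> /N_bounded[].
have FY k := Ygen_F2 hS k.
split.
- split; first by move=> T [/N_bounded].
  split=> // ; have <- : pi 1 = idfun by case: gns_rep.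
  exact/N_pi/F2_1.
- move=> a T U [NT cT] [NU cU]; split; first exact: N_lin.
  by move=> k v; rewrite (pi_lin (FY k)) cT cU.
- move=> T U [NT cT] [NU cU]; split; first exact: N_comp.
  by move=> k v /=; rewrite cU cT.
- move=> T U [NT cT] TU; split.
    by apply: (wot_closure_adj hdot pi_F2_adj NT TU).
  move=> k v; apply: (dot_inj hdot) => w.
  by rewrite (adjoint_opC TU) !dot_pi // Ygen_star // (adjoint_opC TU) -cT.
- move=> T MT; split.
    by apply: wot_closure_idem; apply: wot_closure_mono MT => U [].
  move=> k v; apply: (dot_inj hdot) => w; rewrite dot_pi // Ygen_star //.
  apply: (wot_closure_coef MT) => U [_ cU].
  by rewrite cU dot_pi // Ygen_star.
Qed.

Lemma fixed_von_neumann : [set T | N T /\ Lam T = T] =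
  vN_gen dot [set pi x | x in [set x | F2alg S x /\ lam x = x]].
Proof.
apply/seteqP; split=> T.
  move=> [NT LT] M [[Mb _ _ _ Mcl] GM]; apply/Mcl/(wot_closure_mono GM).
  apply: approx_wot_closure => // n; split; last exact: fixed_approx.
  by exists n => //; exact: approx_F2n.
have -> : [set T | N T /\ Lam T = T] = [set T | N T /\ comm_Ygens T].
  by apply/seteqP; split=> U [NU cU]; split=> //; [exact: fixed_comm|exact: comm_fixed].
move=> /(_ _ (conj comm_von_neumann _)); apply=> _ [x [Fx lx] <-].
have Fx2 := F2alg_F2 Fx; have NP := N_pi Fx2.
by split=> //; apply: fixed_comm => //; rewrite hext // lx.
Qed.

End GNS.

Theorem proposition8p2 (R : realType)
    (* O_2 with its generators, and lambda_{R_4} *)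
    (O : cstarAlgType R) (S : 'I_2 -> O) (hS : cuntz_algebra S)
    (q : R[i]) (hq : `|q| = 1)
    (lam : {lrmorphism O -> O}) (hlam : cuntz_endo S (of_mx2 S (R4 q)) lam)
    (* the GNS representation of the normalized trace of F_2 *)
    (tau : O -> R[i]) (htau : normalized_trace (F2 S) tau)
    (H : completeNormedModType R[i]) (dot : {dot H for (@Num.conj R[i])})
    (hdot : hilbert_dot dot)
    (pi : O -> H -> H) (Om : H) (hpi : gns_triple dot (F2 S) tau pi Om)
    (* N, and the normal extension of lambda_{R_4} to it *)
    (N : set (H -> H)) (hN : N = wot_closure dot (pi @` F2 S))
    (Lam : (H -> H) -> H -> H) (hLam : normal_endo dot N Lam)
    (hext : forall x, F2 S x -> Lam (pi x) = pi (lam x)) :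
  [/\ forall n : nat, (1 <= n)%N -> forall x, F2n S n x ->
        (lam x = x <->
         lspan [set y | exists2 i : nat -> 'I_4,
                          admissible n i & y = pauli_string S n i] x),
      forall n : nat, (1 <= n)%N ->
        has_dim [set x | F2n S n x /\ lam x = x] (2 ^ n)
    & [set T | N T /\ Lam T = T] =
      vN_gen dot [set pi x | x in [set x | F2alg S x /\ lam x = x]]].
Proof.
subst N; split=> [n n1 x Fx|n _|].
- exact: (fixed_points_F2n hS htau hq hlam n1 Fx).
- exact: (dim_fixed_points hS htau hq hlam n).
- exact: (fixed_von_neumann hS htau hdot hpi hq hlam hLam hext).
Qed.
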